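(* For $\Delta\vdash d$, normalize the genus expanded cut-and-join operator $W(\Delta,z)$ by the factor $z^{-d+l(\Delta)}$: $$\hat W(\Delta,z):=z^{-d+l(\Delta)}W(\Delta,z).$$ Then for a given $d$, as operators on the space of functions in the time-variables $p=(p_1,p_2,\dots)$, all the operators $\hat W(\Delta,z)$ for $\Delta\vdash d$ form a commutative associative algebra, denoted by $\mathcal{W}_d$, with $$\hat W(\Delta_1,z)\,\hat W(\Delta_2,z)=\sum_{\Delta_3\vdash d}C_{\Delta_1\Delta_2}^{\Delta_3}\,\hat W(\Delta_3,z)\qquad(\Delta_1,\Delta_2\vdash d),$$ where $C_{\Delta_1\Delta_2}^{\Delta_3}=\frac{d!}{|C_{\Delta_3}|}\mu_0^{h,d}(\Delta_1,\Delta_2,\Delta_3)$ are the structure constants of the central subalgebra $Z(\mathbb{C}[S_d])$ of the group algebra $\mathbb{C}[S_d]$; i.e., there is an algebra isomorphism $$\mathcal{W}_d\cong Z(\mathbb{C}[S_d]),\qquad \hat W(\Delta,z)\mapsto C_\Delta.$$ Moreover, the operators $\hat W(\Delta,z)$ have the genus expanded Schur functions $S_\lambda\{p,z\}$ ($\lambda\vdash d$) as their eigenfunctions and $\phi_\lambda(\Delta)$ as the corresponding eigenvalues: $$\hat W(\Delta,z)\,S_\lambda\{p,z\}=\phi_\lambda(\Delta)\,S_\lambda\{p,z\}.$$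
   Context: The time-variables $p=(p_1,p_2,\dots)$ are indeterminates, and $z$ is a further parameter. For a partition $\Delta=(\delta_1,\dots,\delta_n)\vdash d$: $l(\Delta)=n$; $m_r(\Delta)=\#\{i:\delta_i=r\}$; $\Delta!=\prod_{r\ge1}m_r(\Delta)!$; $p_\Delta=p_{\delta_1}\cdots p_{\delta_n}$; $\frac{\partial}{\partial p_\Delta}=\frac{1}{\Delta!}\frac{\partial}{\partial p_{\delta_1}}\cdots\frac{\partial}{\partial p_{\delta_n}}$. $S_d$ is the symmetric group on $d$ letters; $C_\Delta\in Z(\mathbb{C}[S_d])$ is the central element corresponding to $\Delta$ (the sum of all permutations in $S_d$ of cycle type $\Delta$), and $|C_\Delta|$ is the number of such permutations. The structure constants are taken with respect to the elements $C_\Delta$, $\Delta\vdash d$. For $\lambda\vdash d$, $\dim\lambda$ and $\chi_\lambda(\Delta)$ denote the dimension of the irreducible representation of $S_d$ indexed by $\lambda$ and its character value on permutations of cycle type $\Delta$, and $\phi_\lambda(\Delta)=\frac{1}{\dim\lambda}|C_\Delta|\chi_\lambda(\Delta)$. Generalized Hurwitz numbers: for $g\ge0$ and $\Delta_1,\dots,\Delta_k\vdash d$, $\mu_g^{h,d}(\Delta_1,\dots,\Delta_k)$ denotes the generalized Hurwitz number counting, up to equivalence, degree $d$ ramified coverings of a connected compact Riemann surface of genus $g$ by possibly disconnected compact Riemann surfaces of genus $h$, with ramification types $\Delta_1,\dots,\Delta_k$ over $k$ given points. It is given by $$\mu_g^{h,d}(\Delta_1,\dots,\Delta_k)=\sum_{\lambda\vdash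 d}\Big(\frac{\dim\lambda}{d!}\Big)^{2-2g}\phi_\lambda(\Delta_1)\cdots\phi_\lambda(\Delta_k),$$ where $h$ is determined by the Hurwitz formula $(2-2g)d-(2-2h)=\sum_{i=1}^k(d-l(\Delta_i))$. Genus expanded cut-and-join operator of $\Delta\vdash d$: $$W(\Delta,z)=\sum_{\Gamma,\Gamma'\vdash d}\frac{d!}{|C_{\Gamma'}|}\,z^{\,d+l(\Gamma')-l(\Delta)-l(\Gamma)}\,\mu_0^{h_+,d}(\Gamma',\Delta,\Gamma)\,p_\Gamma\frac{\partial}{\partial p_{\Gamma'}},$$ with $h_+$ determined by $2d-(2-2h_+)=(d-l(\Gamma'))+(d-l(\Delta))+(d-l(\Gamma))$. Genus expanded Schur function of $\lambda\vdash d$: $$S_\lambda\{p,z\}=\sum_{\Gamma'\vdash d}z^{-d-l(\Gamma')}\frac{\dim\lambda}{d!}\phi_\lambda(\Gamma')\,p_{\Gamma'}.$$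
   Formalization: The operators act on polynomials in p homogeneous of degree d (deg p_k = k), not on all functions of p; there the product rule fails: for d=1, Ŵ = p_1∂/∂p_1 and C=1, but (p_1∂/∂p_1)^2 and p_1∂/∂p_1 differ on p_1^2. *)

(* Defs.v *)
From HB Require Import structures.
From mathcomp Require Import all_boot all_order all_algebra all_fingroup.
From mathcomp Require Import all_solvable all_field all_character.
From mathcomp Require Import finmap monalg.

Set Implicit Arguments.
Unset Strict Implicit.
Unset Printing Implicit Defensive.

Import Order.TTheory GRing.Theory Num.Theory.
Local Open Scope ring_scope.

Record intpart (d : nat) := IntPart {
  parts :> seq nat;
  partsP : [&& sorted geq parts, 0%N \notin parts & sumn parts == d] }.

HB.instance Definition _ d := [isSub for @parts d].
HB.instance Definition _ d := [Countable of intpart d by <:].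

Lemma leq_sumn (s : seq nat) k : k \in s -> (k <= sumn s)%N.
Proof.
elim: s => //= a s IHs; rewrite inE => /orP[/eqP-> | /IHs ks].
  exact: leq_addr.
exact: leq_trans ks (leq_addl _ _).
Qed.

Lemma size_leq_sumn (s : seq nat) : 0%N \notin s -> (size s <= sumn s)%N.
Proof.
elim: s => //= a s IHs; rewrite inE negb_or eq_sym -lt0n => /andP[a0 /IHs].
by rewrite -add1n; apply: leq_add.
Qed.

Section IntpartFinite.
Variable d : nat.

Definition bseq_of_intpart (D : intpart d) : d.-bseq 'I_d.+1 :=
  insub_bseq d [seq inord k | k <- D].

Definition intpart_of_bseq (b : d.-bseq 'I_d.+1) : option (intpart d) :=
  insub (map val b).

Lemma bseq_of_intpartK : pcancel bseq_of_intpart intpart_of_bseq.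
Proof.
move=> D; have /and3P[_ D0 /eqP sD] := partsP D.
rewrite /intpart_of_bseq /bseq_of_intpart /insub_bseq insubdK; last first.
  by rewrite unfold_in size_map -[X in (_ <= X)%N]sD size_leq_sumn.
have -> : [seq val i | i <- [seq (inord k : 'I_d.+1) | k <- D]] = D :> seq nat.
  rewrite -map_comp -[RHS]map_id; apply/eq_in_map => k kD /=.
  by rewrite inordK // ltnS -[X in (_ <= X)%N]sD leq_sumn.
by rewrite valK.
Qed.

HB.instance Definition _ : isFinite (intpart d) :=
  PCanIsFinite bseq_of_intpartK.

End IntpartFinite.

(* prod_r m_r(D)!, where m_r(D) is the number of parts of D equal to r. *)
Definition part_fact (D : seq nat) : nat :=
  \prod_(r <- undup D) (count_mem r D)`!.

Definition cycle_type (d : nat) (s : 'S_d) : seq nat :=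
  sort geq [seq #|A| | A : {set 'I_d} in porbits s].

Definition cclass (d : nat) (D : intpart d) : {set 'S_d} :=
  [set s | cycle_type s == D].

(* C[S_d] is the algebra spanned by the matrices of the regular               *)
(* representation; gset_mx sends a set of permutations to their formal sum.   *)
Definition class_sum (C : fieldType) (d : nat) (D : intpart d) :
    'M[C]_#|[set: 'S_d]| :=
  gset_mx C [set: 'S_d] (cclass D).

(* 'I_d is identified with the boxes of the diagram of l, numbered row by     *)
(* row: box x lies in row reshape_index l x and column reshape_offset l x.    *)
(* The irreducible representation indexed by l is the module C[S_d] c_l       *)
(* generated by the Young symmetrizer c_l = (row sum) (signed column sum).    *)
(* In MathComp (s * t) x = t (s x) and modules are right modules, so that     *)
(* this left module for the usual composition of maps becomes the right       *)
(* module c_l C[S_d], with the two factors of c_l in reverse order.           *)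

Section Specht.
Variables (C : fieldType) (d : nat) (l : intpart d).

Definition row_group : {set 'S_d} :=
  [set s : 'S_d | [forall x, reshape_index l (s x) == reshape_index l x]].

Definition col_group : {set 'S_d} :=
  [set s : 'S_d | [forall x, reshape_offset l (s x) == reshape_offset l x]].

Let rG := regular_repr C [set: 'S_d].

Definition young_symmetrizer : 'M[C]_#|[set: 'S_d]| :=
  (\sum_(q in col_group) (-1) ^+ odd_perm q *: rG q)
    *m (\sum_(p in row_group) rG p).

Definition specht_mx : 'M[C]_#|[set: 'S_d]| :=
  cyclic_mx rG (gring_row young_symmetrizer).

Definition specht_repr : mx_representation C [set: 'S_d] (\rank specht_mx) :=
  submod_repr (cyclic_mx_module rG (gring_row young_symmetrizer)).

Definition irr_dim : nat := \rank specht_mx.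

(* The value of the character on any permutation of cycle type D. *)
Definition irr_char (D : intpart d) : C :=
  \tr (specht_repr (repr (cclass D))).

Definition phi (D : intpart d) : C :=
  irr_dim%:R^-1 * #|cclass D|%:R * irr_char D.

End Specht.

(* The superscript h of mu_g^{h,d}(Ds) is determined by g, d and Ds through   *)
(* the Hurwitz formula, and is therefore not an argument.                     *)
Definition hurwitz (C : fieldType) (g d : nat) (Ds : seq (intpart d)) : C :=
  \sum_(l : intpart d)
    ((irr_dim C l)%:R / d`!%:R) ^ (2%:Z - (2 * g)%:Z)
    * \prod_(D <- Ds) phi C l D.

(* C[p_1, p_2, ...].  The variables are indexed from 0 in {cmonom nat}: the   *)
(* index i stands for p_(i + 1).  Hence tvar and tderiv below, which denote   *)
(* p_k and d/dp_k, are only meaningful for k > 0.                             *)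
Notation tpoly C := {malg C[{cmonom nat}]}.

Section TimeVariables.
Variable C : fieldType.

Definition tvar (k : nat) : tpoly C := << ucm k.-1 >>.

Definition tderiv (k : nat) (f : tpoly C) : tpoly C :=
  \sum_(m <- msupp f) << f@_m *+ m k.-1 *g divcm m (ucm k.-1) >>.

Definition tvar_part (D : seq nat) : tpoly C := \prod_(k <- D) tvar k.

Definition tderiv_part (D : seq nat) (f : tpoly C) : tpoly C :=
  (part_fact D)%:R^-1 *: foldr tderiv f D.

(* W(D, z) and z^(- d + l(D)) W(D, z), on all of C[p_1, p_2, ...]. *)
Definition cut_join (d : nat) (D : intpart d) (z : C) (f : tpoly C) : tpoly C :=
  \sum_(G : intpart d) \sum_(G' : intpart d)
    (d`!%:R / #|cclass G'|%:R
       * z ^ (d%:Z + (size G')%:Z - (size D)%:Z - (size G)%:Z)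
       * hurwitz C 0 [:: G'; D; G])
    *: (tvar_part G * tderiv_part G' f).

Definition cut_join_hat (d : nat) (D : intpart d) (z : C) (f : tpoly C) :
    tpoly C :=
  z ^ (- d%:Z + (size D)%:Z) *: cut_join D z f.

(* The genus expanded Schur function S_l{p, z}. *)
Definition schur (d : nat) (l : intpart d) (z : C) : tpoly C :=
  \sum_(G' : intpart d)
    (z ^ (- d%:Z - (size G')%:Z) * ((irr_dim C l)%:R / d`!%:R) * phi C l G')
    *: tvar_part G'.

End TimeVariables.

Definition struct_const (C : fieldType) (d : nat) (D1 D2 D3 : intpart d) : C :=
  d`!%:R / #|cclass D3|%:R * hurwitz C 0 [:: D1; D2; D3].

(* p_k has degree k. *)
Definition twgt (m : {cmonom nat}) : nat :=
  (\sum_(i <- finsupp m) m i * i.+1)%N.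

Definition thomog (C : fieldType) (d : nat) : {pred tpoly C} :=
  fun f => all (fun m => twgt m == d) (msupp f).
Arguments thomog : clear implicits.

Lemma twgtEw (m : {cmonom nat}) (A : {fset nat}) :
  (finsupp m `<=` A)%fset -> twgt m = (\sum_(i <- A) m i * i.+1)%N.
Proof.
move=> le; rewrite /twgt (big_fset_incl _ le) //.
by move=> i _ mi; rewrite [m i](fsfun_dflt mi).
Qed.

Lemma twgtM (m1 m2 : {cmonom nat}) :
  twgt (mulcm m1 m2) = (twgt m1 + twgt m2)%N.
Proof.
rewrite (twgtEw (m := mulcm m1 m2) (A := (finsupp m1 `|` finsupp m2)%fset)).
  rewrite (twgtEw (fsubsetUl _ (finsupp m2))).
  rewrite (twgtEw (fsubsetUr (finsupp m1) _)) -big_split /=.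
  by apply: eq_bigr => i _; rewrite mulcmE mulnDl.
by rewrite -mdomD fsubset_refl.
Qed.

Lemma twgtU i : twgt (ucm i) = i.+1.
Proof. by rewrite /twgt mdomU big_seq_fset1 ucmE eqxx mul1n. Qed.

Lemma twgt1 : twgt (onecm nat) = 0%N.
Proof. by rewrite /twgt mdom1 big_seq_fset0. Qed.

Section Homogeneous.
Variable C : fieldType.
Implicit Types f g : tpoly C.

Lemma thomogP d f :
  reflect (forall m, f@_m != 0 -> twgt m = d) (f \in thomog C d).
Proof.
apply: (iffP allP) => [Hf m | Hf m].
  by rewrite mcoeff_neq0 => /Hf/eqP.
by rewrite -mcoeff_neq0 => /Hf->.
Qed.

Lemma thomog_submod_closed d : submod_closed (thomog C d).
Proof.
split=> [|c f g /thomogP Hf /thomogP Hg].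
  by apply/thomogP=> m; rewrite mcoeff0 eqxx.
apply/thomogP=> m; rewrite mcoeffD mcoeffZ => nz.
have [fm0 | /Hf//] := eqVneq (f@_m) 0; apply: Hg.
by rewrite fm0 mulr0 add0r in nz.
Qed.

HB.instance Definition _ d :=
  GRing.isSubmodClosed.Build C (tpoly C) (thomog C d) (thomog_submod_closed d).

Lemma thomogU (c : C) (m : {cmonom nat}) d :
  twgt m = d -> (<< c *g m >> : tpoly C) \in thomog C d.
Proof.
move=> wm; apply/thomogP=> m'; rewrite mcoeffU.
by have [<- //|_] := eqVneq m m'; rewrite eqxx.
Qed.

Lemma thomogM d e f g :
  f \in thomog C d -> g \in thomog C e -> f * g \in thomog C (d + e).
Proof.
move=> /thomogP Hf /thomogP Hg.
rewrite (_ : f * g = fgmul f g) //; apply: rpred_sum => m1 _.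
apply: rpred_sum => m2 _.
have [f0 | /Hf w1] := eqVneq (f@_m1) 0.
  by rewrite f0 mul0r monalgU0 rpred0.
have [g0 | /Hg w2] := eqVneq (g@_m2) 0.
  by rewrite g0 mulr0 monalgU0 rpred0.
by apply: thomogU; rewrite twgtM w1 w2.
Qed.

Lemma thomog_tvar_part (D : seq nat) :
  0%N \notin D -> tvar_part C D \in thomog C (sumn D).
Proof.
rewrite /tvar_part; elim: D => [_|k D IHD]; rewrite ?big_nil ?big_cons.
  exact: thomogU twgt1.
rewrite inE negb_or eq_sym -lt0n => /andP[k0 /IHD HD].
by apply: thomogM HD; apply: thomogU; rewrite twgtU prednK.
Qed.

Lemma thomog_tderiv k w f :
  (0 < k)%N -> f \in thomog C (w + k) -> tderiv k f \in thomog C w.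
Proof.
move=> k0 /thomogP Hf; apply: rpred_sum => m _.
have [f0 | /Hf wm] := eqVneq (f@_m) 0; first by rewrite f0 mul0rn monalgU0 rpred0.
have [m0 | mk] := eqVneq (m k.-1) 0%N; first by rewrite m0 mulr0n monalgU0 rpred0.
apply: thomogU; apply/eqP; rewrite -(eqn_add2r k) -wm -{2}(prednK k0) -twgtU.
rewrite -twgtM; apply/eqP; congr twgt; apply/eqP/cmP=> i.
rewrite mulcmE divcmE ucmE; case: eqP => [<-|_]; last by rewrite subn0 addn0.
by rewrite subnK // lt0n.
Qed.

Lemma thomog_tderiv_part (D : seq nat) w f :
  0%N \notin D -> f \in thomog C (w + sumn D) -> tderiv_part D f \in thomog C w.
Proof.
move=> D0 Hf; apply: rpredZ; elim: D => [|k D IHD] /= in w D0 Hf *.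
  by rewrite addn0 in Hf.
move: D0; rewrite inE negb_or eq_sym -lt0n => /andP[k0 D0].
by apply: thomog_tderiv => //; apply: IHD; rewrite // -addnA.
Qed.

Lemma thomog_cut_join_hat d (D : intpart d) z f :
  f \in thomog C d -> cut_join_hat D z f \in thomog C d.
Proof.
move=> Hf; apply: rpredZ; apply: rpred_sum => G _; apply: rpred_sum => G' _.
apply: rpredZ; have /and3P[_ G0 /eqP sG] := partsP G.
have /and3P[_ G0' /eqP sG'] := partsP G'.
suff: tvar_part C G * tderiv_part G' f \in thomog C (sumn G + 0).
  by rewrite sG addn0.
by apply: thomogM; [apply: thomog_tvar_part|apply: thomog_tderiv_part; rewrite ?sG'].
Qed.

End Homogeneous.

Record tfun (C : fieldType) (d : nat) := TFun {
  tfun_val :> tpoly C;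
  tfunP : tfun_val \in thomog C d }.

HB.instance Definition _ C d := [isSub for @tfun_val C d].
HB.instance Definition _ C d := [Choice of tfun C d by <:].
HB.instance Definition _ C d := [SubChoice_isSubLmodule of tfun C d by <:].


Section TfunVector.
Variables (C : fieldType) (d : nat).

Definition part_mon (D : seq nat) : {cmonom nat} :=
  foldr (fun k => mulcm (ucm k.-1)) (onecm nat) D.

Lemma part_monE (D : seq nat) i :
  0%N \notin D -> part_mon D i = count_mem i.+1 D.
Proof.
elim: D => [|k D IHD]; first by rewrite onecmE.
rewrite inE negb_or eq_sym -lt0n => /andP[k0 /IHD HD] /=.
by rewrite mulcmE ucmE HD -[in RHS](prednK k0) eqSS.
Qed.

Lemma twgt_part_mon (D : seq nat) :
  0%N \notin D -> twgt (part_mon D) = sumn D.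
Proof.
elim: D => [|k D IHD]; first by rewrite twgt1.
rewrite inE negb_or eq_sym -lt0n => /andP[k0 /IHD HD] /=.
by rewrite twgtM twgtU HD prednK.
Qed.

Lemma part_mon_inj : injective (fun D : intpart d => part_mon D).
Proof.
move=> D E eqDE; apply: val_inj => /=.
have /and3P[sD D0 _] := partsP D; have /and3P[sE E0 _] := partsP E.
apply: (@sorted_eq _ geq) => //.
- by move=> a b c /= ba cb; apply: leq_trans cb ba.
- by move=> a b /= /andP[ab ba]; apply/eqP; rewrite eqn_leq ab ba.
apply/allP=> -[_ | i _] /=; first by rewrite !(count_memPn _).
by rewrite -!part_monE // eqDE.
Qed.

Lemma part_mon_surj (m : {cmonom nat}) :
  twgt m = d -> exists D : intpart d, part_mon D = m.
Proof.
move=> wm; pose s := flatten [seq nseq (m i) i.+1 | i <- finsupp m].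
have s0 : 0%N \notin s.
  by apply/flatten_mapP=> -[i _]; rewrite mem_nseq andbF.
have ss : sumn s = d.
  rewrite -wm /twgt /s; elim: (enum_fset _) => [|i r IHr] /=.
    by rewrite big_nil.
  by rewrite sumn_cat IHr big_cons sumn_nseq mulnC.
have cs i : count_mem i.+1 s = m i.
  rewrite /s count_flatten -map_comp sumnE big_map.
  under eq_bigr => j _ do rewrite /= count_nseq /= eqSS.
  have [im | iNm] := boolP (i \in finsupp m).
    rewrite (big_fsetD1 i) //= eqxx mul1n big1_fset ?addn0 // => j.
    by rewrite in_fsetD1 => /andP[/negPf-> _] _; rewrite mul0n.
  rewrite fsfun_dflt // big1_seq // => j /andP[_ jm].
  by case: eqP jm iNm => [-> -> | _ _ _] //; rewrite mul0n.
have sP : [&& sorted geq (sort geq s), 0%N \notin sort geq s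
            & sumn (sort geq s) == d].
  rewrite mem_sort s0 sort_sorted; last by move=> a b; apply: leq_total.
  by rewrite /= -ss !sumnE; apply/eqP/perm_big; rewrite perm_sort.
exists (IntPart sP); apply/eqP/cmP=> i.
by rewrite part_monE ?mem_sort // count_sort -cs.
Qed.

Lemma mcoeff_sumU (I : finType) (x : I -> C) (u : I -> {cmonom nat}) m :
  (\sum_i << x i *g u i >> : tpoly C)@_m = \sum_i x i *+ (u i == m).
Proof. by rewrite raddf_sum; apply: eq_bigr => i _; exact: mcoeffU. Qed.

Definition enum_mon (i : 'I_#|{: intpart d}|) : {cmonom nat} :=
  part_mon (enum_val i : intpart d).

Lemma enum_mon_inj : injective enum_mon.
Proof. by move=> i j /part_mon_inj/enum_val_inj. Qed.

Lemma enum_mon_surj m : twgt m = d -> exists i, enum_mon i = m.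
Proof.
move=> /part_mon_surj[D <-]; exists (enum_rank D).
by rewrite /enum_mon enum_rankK.
Qed.

Lemma twgt_enum_mon i : twgt (enum_mon i) = d.
Proof.
have /and3P[_ D0 /eqP sD] := partsP (enum_val i : intpart d).
by rewrite /enum_mon twgt_part_mon.
Qed.

Definition tfun_coord (f : tfun C d) : 'rV[C]_#|{: intpart d}| :=
  \row_i (tfun_val f)@_(enum_mon i).

Lemma tfun_of_coord_subproof (v : 'rV[C]_#|{: intpart d}|) :
  (\sum_i << v 0 i *g enum_mon i >> : tpoly C) \in thomog C d.
Proof.
by apply: rpred_sum => i _; apply: thomogU; apply: twgt_enum_mon.
Qed.

Definition tfun_of_coord (v : 'rV[C]_#|{: intpart d}|) : tfun C d :=
  TFun (tfun_of_coord_subproof v).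

Lemma sum_enum_mon (x : 'I_#|{: intpart d}| -> C) i :
  \sum_j x j *+ (enum_mon j == enum_mon i) = x i.
Proof.
rewrite (bigD1 i isT) eqxx mulr1n big1 => [|j /negPf ji]; first exact: addr0.
by rewrite (inj_eq enum_mon_inj) ji.
Qed.

Lemma tfun_coordK : cancel tfun_coord tfun_of_coord.
Proof.
move=> f; apply: val_inj; apply/malgP=> m.
rewrite [LHS]mcoeff_sumU; have [fm0 | ] := eqVneq ((tfun_val f)@_m) 0.
  rewrite fm0 big1 // => i _; rewrite mxE.
  by case: eqP => // ->; rewrite fm0 mul0rn.
move/(thomogP _ _ (tfunP f))/enum_mon_surj => [i <-].
by rewrite sum_enum_mon mxE.
Qed.

Lemma tfun_of_coordK : cancel tfun_of_coord tfun_coord.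
Proof.
by move=> v; apply/rowP=> i; rewrite mxE mcoeff_sumU sum_enum_mon.
Qed.

Lemma tfun_vect_axiom : vector_axiom #|{: intpart d}| (tfun C d).
Proof.
exists tfun_coord; last by exists tfun_of_coord;
  [exact: tfun_coordK | exact: tfun_of_coordK].
by move=> a f g; apply/rowP=> i; rewrite !mxE mcoeffD mcoeffZ.
Qed.

HB.instance Definition _ := Lmodule_hasFinDim.Build C (tfun C d) tfun_vect_axiom.

End TfunVector.

Lemma tderiv_is_linear (C : fieldType) k : linear (@tderiv C k).
Proof.
have tderivEw (f : tpoly C) (A : {fset {cmonom nat}}) :
    (msupp f `<=` A)%fset ->
  tderiv k f = \sum_(m <- A) << f@_m *+ m k.-1 *g divcm m (ucm k.-1) >>.
  move=> le; apply: big_fset_incl le _ => m _ /mcoeff_outdom ->.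
  by rewrite mul0rn monalgU0.
move=> a f g; pose A := (msupp f `|` msupp g)%fset.
have sA : (msupp (a *: f + g) `<=` A)%fset.
  apply: fsubset_trans (msuppD_le _ _) _; apply: fsetSU; exact: msuppZ_le.
rewrite (tderivEw _ _ sA) (tderivEw f A) ?fsubsetUl //.
rewrite (tderivEw g A) ?fsubsetUr // scaler_sumr -big_split /=.
apply: eq_bigr => m _; apply/malgP => m'.
rewrite mcoeffD mcoeffZ !mcoeffU mcoeffD mcoeffZ !mulrnDl.
congr (_ + _); last by rewrite [RHS]mcoeffU.
by rewrite [in RHS]mcoeffU !mulrnAr.
Qed.

Lemma cut_join_hat_is_linear (C : fieldType) d (D : intpart d) (z : C) :
  linear (cut_join_hat D z).
Proof.
have lin (E : seq nat) : linear (@tderiv_part C E).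
  move=> a f g; rewrite /tderiv_part.
  suff -> : foldr (@tderiv C) (a *: f + g) E =
            a *: foldr (@tderiv C) f E + foldr (@tderiv C) g E.
    by rewrite scalerDr scalerA mulrC -scalerA.
  by elim: E => //= k E ->; apply: tderiv_is_linear.
have swap (a b : C) (x : tpoly C) : a *: (b *: x) = b *: (a *: x).
  by rewrite !scalerA mulrC.
have swapD (a b : C) (x y : tpoly C) :
  b *: (a *: x + y) = a *: (b *: x) + b *: y by rewrite scalerDr swap.
have lin_sum (I : finType) (F : I -> tpoly C -> tpoly C) :
    (forall i, linear (F i)) -> linear (fun f => \sum_i F i f).
  move=> linF a f g; rewrite scaler_sumr -big_split.
  by apply: eq_bigr => i _; apply: linF.
have lin_term (c : C) (h : tpoly C) (E : seq nat) :
    linear (fun f => c *: (h * @tderiv_part C E f)).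
  have := lin E; move: (@tderiv_part C E) => t lint a f g.
  rewrite lint mulrDr (_ : h * (a *: t f) = a *: (h * t f)).
    exact: swapD.
  by rewrite scalerAr.
have linW : linear (cut_join D z).
  by apply: (lin_sum) => G; apply: (lin_sum) => G'; apply: lin_term.
by move=> a f g; rewrite /cut_join_hat linW; apply: swapD.
Qed.

Definition W_fun (C : fieldType) (d : nat) (D : intpart d) (z : C)
    (f : tfun C d) : tfun C d :=
  TFun (thomog_cut_join_hat D z (tfunP f)).

Lemma W_fun_is_linear (C : fieldType) d (D : intpart d) (z : C) :
  linear (W_fun D z).
Proof. by move=> a f g; apply: val_inj; apply: cut_join_hat_is_linear. Qed.

HB.instance Definition _ (C : fieldType) d (D : intpart d) (z : C) :=
  GRing.isLinear.Build C (tfun C d) (tfun C d) _ (W_fun D z)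
    (W_fun_is_linear D z).

(* cut_join_hat D z, as an operator on the functions of degree d.  The        *)
(* multiplication rule holds only there: for d = 1 the operator is            *)
(* p_1 d/dp_1, which is the unit of the algebra but maps p_1^2 to 2 p_1^2.    *)
Definition W_hat (C : fieldType) (d : nat) (D : intpart d) (z : C) :
    'End(tfun C d) :=
  linfun (W_fun D z).

Lemma W_hatE (C : fieldType) d (D : intpart d) (z : C) (f : tfun C d) :
  tfun_val (W_hat D z f) = cut_join_hat D z (tfun_val f).
Proof. by rewrite lfunE. Qed.

Definition W_alg (C : fieldType) (d : nat) (z : C) : {vspace 'End(tfun C d)} :=
  <<[seq W_hat D z | D : intpart d]>>%VS.

(* Main.v *)
Require Import Defs.
From HB Require Import structures.
From mathcomp Require Import all_boot all_order all_algebra all_fingroup.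
From mathcomp Require Import all_solvable all_field all_character.
From mathcomp Require Import finmap monalg ring.

Set Implicit Arguments.
Unset Strict Implicit.
Unset Printing Implicit Defensive.

Import Order.TTheory GRing.Theory Num.Theory.
Local Open Scope ring_scope.

(* The Young symmetrizer c_l satisfies c_l x c_l = (scalar) c_l, and for l <> m
   one of c_l x c_m, c_m x c_l vanishes for all x.  Taking traces of
   u |-> c_l u g on the regular representation turns these identities into
   n_l f_l = d! (with c_l^2 = n_l c_l and f_l the dimension), the formula
   n_l chi_l(g) = sum_h c_l(h g^-1 h^-1), and the orthogonality of the chi_l.
   As there are as many l as conjugacy classes, column orthogonality follows.
   Class sums act on c_l by the scalars phi_l, which are thus multiplicative,
   and column orthogonality identifies struct_const with the structure constants of
   the class sums.  In the basis p_D, up to powers of z, the matrix of W_hat D z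
   is the transpose of that of multiplication by the class sum of D. *)

(** * Cycle types *)

(** The modules [specht_mx] are given only by a generator, so even f_l <> 0 has to be proved. It
    comes, together with n_l <> 0, from n_l f_l = d! in characteristic 0, and every later division
    rests on it. Since g and g^-1 have the same cycle type, chi_l(g^-1) = chi_l(g), and the
    orthogonality relations are bilinear, without complex conjugation. For l <> m only one of the
    two orders of the symmetrizers is known to give zero (which one depends on a dominance
    comparison of the diagrams), but the sum of chi_l chi_m is symmetric, so one order is enough.
    The factor z^(l(D) - d) leaves the power z^(l(E) - l(G)) on the coefficient leading from p_E to
    p_G. This is a change of basis by a diagonal matrix: z disappears from the multiplication rule
    and from the eigenvalues, and survives only in the eigenvectors. Transposition reverses
    products, which is harmless because class sums commute. *)

Section Boxes.
Variables (d : nat) (l : intpart d).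
Implicit Types x y : 'I_d.

Lemma sumn_intpart : sumn l = d.
Proof. by have /and3P[_ _ /eqP] := partsP l. Qed.

Lemma intpart_neq0 : 0%N \notin (l : seq nat).
Proof. by have /and3P[] := partsP l. Qed.

Lemma intpart_sorted : sorted geq l.
Proof. by have /and3P[] := partsP l. Qed.

Lemma box_subproof r c (lt_c : (c < nth 0 l r)%N) : (flatten_index l r c < d)%N.
Proof. by rewrite -[ltnRHS]sumn_intpart; apply: flatten_indexP. Qed.

Definition box r c (lt_c : (c < nth 0 l r)%N) : 'I_d := Ordinal (box_subproof lt_c).

Lemma box_row x : (reshape_index l x < size l)%N.
Proof. by apply: reshape_indexP; rewrite sumn_intpart. Qed.

Lemma box_col x : (reshape_offset l x < nth 0 l (reshape_index l x))%N.
Proof. by apply: reshape_offsetP; rewrite sumn_intpart. Qed.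

Lemma box_inj x y : reshape_index l x = reshape_index l y ->
  reshape_offset l x = reshape_offset l y -> x = y.
Proof.
by move=> eqr eqc; apply: val_inj; rewrite /= -(reshape_indexK l x) eqr eqc reshape_indexK.
Qed.

Lemma box_colK r c (lt_c : (c < nth 0 l r)%N) : reshape_offset l (box lt_c) = c.
Proof. exact: flatten_indexKr. Qed.

Lemma box_rowK r c (lt_c : (c < nth 0 l r)%N) : reshape_index l (box lt_c) = r.
Proof. exact: flatten_indexKl. Qed.

Lemma nth_intpart_gt0 r : (r < size l)%N -> (0 < nth 0 l r)%N.
Proof.
by move=> lt_r; rewrite lt0n; apply: contraNneq intpart_neq0 => <-; apply: mem_nth.
Qed.

End Boxes.

Section CycleType.
Variable d : nat.
Implicit Types (s t : 'S_d) (D : intpart d).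

Lemma geq_total : total geq.
Proof. by move=> a b; apply: leq_total. Qed.

Lemma geq_trans : transitive geq.
Proof. by move=> a b c /= ba cb; apply: leq_trans cb ba. Qed.

Lemma geq_anti : antisymmetric geq.
Proof. by move=> a b /= /andP[ab ba]; apply/eqP; rewrite eqn_leq ab ba. Qed.

Lemma cycle_type_intpart s :
  [&& sorted geq (cycle_type s), 0%N \notin cycle_type s & sumn (cycle_type s) == d].
Proof.
rewrite sort_sorted; last exact: geq_total.
rewrite mem_sort /=; apply/andP; split.
  apply/imageP=> -[A /imsetP[x _ ->] /esym/eqP].
  by apply/negP; apply: card_porbit_neq0.
rewrite sumnE (perm_big _ (permEl (perm_sort _ _))) /= big_map big_enum /=.
have := @card_partition _ (porbits s) [set: 'I_d].
rewrite cardsT card_ord => <- //.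
apply/and3P; split.
- apply/eqP/setP=> x; rewrite inE; apply/bigcupP.
  by exists (porbit s x); rewrite ?porbit_id ?imset_f.
- apply/trivIsetP=> _ _ /imsetP[x _ ->] /imsetP[y _ ->].
  apply: contraNT => /pred0Pn[u /= /andP[]].
  by rewrite -!eq_porbit_mem => /eqP<- /eqP<-.
- by apply/imsetP=> -[x _ e]; have := porbit_id s x; rewrite -e inE.
Qed.

Definition cycle_part s : intpart d := IntPart (cycle_type_intpart s).

Lemma mem_cclass s D : (s \in cclass D) = (cycle_part s == D).
Proof. by rewrite inE -val_eqE. Qed.

Lemma porbitJ s t x : porbit (s ^ t) (t x) = t @: porbit s x.
Proof.
apply/setP=> y; apply/idP/imsetP => [/porbitP[i ->]|[u /porbitP[i ->] ->]].
  exists ((s ^+ i)%g x); first exact: mem_porbit.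
  by rewrite -conjXg permJ.
by apply/porbitP; exists i; rewrite -conjXg permJ.
Qed.

Lemma cycle_typeJ s t : cycle_type (s ^ t) = cycle_type s.
Proof.
have inj_t : injective (fun A : {set 'I_d} => t @: A).
  exact/imset_inj/perm_inj.
apply/(perm_sortP geq_total geq_trans geq_anti).
have -> : porbits (s ^ t) = [set t @: (A : {set 'I_d}) | A in porbits s].
  apply/setP=> B; apply/imsetP/imsetP=> [[x _ ->]|[_ /imsetP[x _ ->] ->]].
    exists (porbit s ((t^-1)%g x)); first exact: imset_f.
    by rewrite -porbitJ permKV.
  by exists (t x); rewrite // porbitJ.
have porbsE : perm_eq (enum [set t @: (A : {set 'I_d}) | A in porbits s])
                      [seq t @: (A : {set 'I_d}) | A in porbits s].
  apply: uniq_perm => [||B]; first exact: enum_uniq.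
    by rewrite map_inj_uniq ?enum_uniq.
  by rewrite mem_enum; apply/imsetP/imageP.
apply: perm_trans (perm_map _ porbsE) _; rewrite -map_comp.
rewrite (eq_map (_ : _ \o _ =1 (fun A : {set 'I_d} => #|A|))) // => A /=.
by rewrite card_imset //; apply: perm_inj.
Qed.

Lemma row_cycle_subproof D (x : 'I_d) :
  ((reshape_offset D x).+1 %% nth 0 D (reshape_index D x)
     < nth 0 D (reshape_index D x))%N.
Proof. by rewrite ltn_pmod // nth_intpart_gt0 // box_row. Qed.

(** The rotation of every row of the diagram by one box: the model to which all permutations of
    cycle type D are conjugate. *)
Definition row_cycle D (x : 'I_d) : 'I_d := box (row_cycle_subproof D x).

Lemma cycle_type_row_cycle s D : cycle_type s = D ->
  exists w : 'S_d, forall x, s (w x) = w (row_cycle D x).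
Proof.
(* The orbits themselves are sorted by decreasing size, so that row r of the diagram is paired with
   an orbit of exactly D_r elements. *)
move=> sD; pose O := sort (relpre (fun A : {set 'I_d} => #|A|) geq) (enum (porbits s)).
have OD : [seq #|A| | A : {set 'I_d} <- O] = D by rewrite -sD -sort_map.
have sO : size O = size D by rewrite -OD size_map.
have uO : uniq O by rewrite sort_uniq enum_uniq.
have [e He] : exists e : 'I_(size D) -> 'I_d,
    forall r : 'I_(size D), nth set0 O r = porbit s (e r).
  suff /fin_all_exists : forall r : 'I_(size D), exists y, nth set0 O r = porbit s y
    by [].
  move=> r.
  have : nth set0 O r \in O by rewrite mem_nth // sO.
  by rewrite mem_sort mem_enum => /imsetP[x _ ->]; exists x.
have card_e r : #|porbit s (e r)| = nth 0%N D r.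
  rewrite -He; move: OD => /(congr1 (nth 0%N ^~ r)).
  by rewrite (nth_map set0) // sO.
pose rw x : 'I_(size D) := Ordinal (box_row D x).
(* Row r is laid along its orbit from a chosen point [e r]: the box in column c goes to the c-th
   iterate of s at [e r]. *)
pose w0 (x : 'I_d) := (s ^+ reshape_offset D x)%g (e (rw x)).
have w0_row (x : 'I_d) : porbit s (w0 x) = nth set0 O (rw x) by rewrite porbit_perm He.
have w0_inj : injective w0.
  move=> x y eq_w; have eq_r : rw x = rw y.
    apply/val_inj/eqP; rewrite -(nth_uniq set0 _ _ uO) ?sO ?ltn_ord //.
    by rewrite -!w0_row eq_w.
  apply: (@box_inj _ D); first by case: eq_r.
  move: eq_w; rewrite /w0 eq_r !permX.
  set r := rw y; have := uniq_traject_porbit s (e r); rewrite card_e => uT.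
  have lx : (reshape_offset D x < nth 0 D r)%N.
    by rewrite -[r]eq_r box_col.
  have ly : (reshape_offset D y < nth 0 D r)%N := box_col D y.
  rewrite -(nth_traject _ lx) -(nth_traject _ ly) => /eqP.
  by rewrite nth_uniq ?size_traject // => /eqP.
exists (perm w0_inj) => x; rewrite !permE /w0.
have -> : rw (row_cycle D x) = rw x by apply: val_inj; exact: box_rowK.
rewrite [reshape_offset D (row_cycle D x)]box_colK -permM -expgSr !permX.
set n := nth _ _ _; set c := (reshape_offset D x).+1.
have itn : iter n s (e (rw x)) = e (rw x) by rewrite -[n](card_e (rw x)) iter_porbit.
rewrite {1}(divn_eq c n) addnC iterD; congr (iter _ _ _).
by elim: (c %/ n)%N => //= k IHk; rewrite mulSn iterD IHk.
Qed.

(** Both permutations are relabelings of the same [row_cycle], and composing the two relabelings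
    conjugates one into the other. *)
Lemma cycle_type_conj s t : cycle_type s = cycle_type t -> exists u, t = (s ^ u)%g.
Proof.
move=> eq_st; pose D := cycle_part s.
have sD : cycle_type s = D by [].
have tD : cycle_type t = D by rewrite -eq_st.
have [v Hv] := cycle_type_row_cycle sD; have [w Hw] := cycle_type_row_cycle tD.
exists (v^-1 * w)%g; apply/permP=> x.
rewrite -(permKV w x) Hw; set y := (w^-1)%g x.
have -> : w y = (v^-1 * w)%g (v y) by rewrite permM permK.
by rewrite permJ Hv permM permK.
Qed.

Lemma row_cycle_inj D : injective (row_cycle D).
Proof.
move=> x y eq_xy.
have eq_r : reshape_index D x = reshape_index D y.
  by rewrite -(box_rowK (row_cycle_subproof D x)) [box _]eq_xy box_rowK.
apply: (box_inj eq_r).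
have : ((reshape_offset D x).+1 %% nth 0 D (reshape_index D x) =
        (reshape_offset D y).+1 %% nth 0 D (reshape_index D y))%N.
  by rewrite -(box_colK (row_cycle_subproof D x)) [box _]eq_xy box_colK.
rewrite eq_r; move: (box_col D x) (box_col D y); rewrite eq_r.
set n := nth _ _ _; move: (reshape_offset _ _) (reshape_offset _ _) => a b an bn.
move/eqP; rewrite -(addn1 a) -(addn1 b) eqn_modDr !modn_small //.
by move/eqP.
Qed.

(** The orbits of the row rotation are the rows of the diagram. This makes [repr (cclass D)] a
    genuine permutation of type D and the class sizes invertible. *)
Lemma cclass_neq0 D : exists s : 'S_d, s \in cclass D.
Proof.
pose s := perm (@row_cycle_inj D); exists s; rewrite inE.
have row_iter x n : reshape_index D (iter n s x) = reshape_index D x.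
  by elim: n => //= n IHn; rewrite permE box_rowK.
have col_iter x n : reshape_offset D (iter n s x) =
    ((reshape_offset D x + n) %% nth 0 D (reshape_index D x))%N.
  elim: n => [|n IHn]; first by rewrite addn0 modn_small // box_col.
  by rewrite iterS permE box_colK row_iter IHn -addn1 modnDml addn1 addnS.
pose R r := [set x : 'I_d | reshape_index D x == r].
have cR r : (r < size D)%N -> #|R r| = nth 0%N D r.
  move=> lt_r; pose h (c : 'I_(nth 0%N D r)) := box (ltn_ord c).
  have inj_h : injective h.
    move=> c c' eq_h; apply: val_inj.
    by rewrite /= -(box_colK (ltn_ord c)) -(box_colK (ltn_ord c')) -!/(h _) eq_h.
  rewrite -[RHS]card_ord -(card_imset _ inj_h) //; apply: eq_card => x; rewrite inE.
  apply/eqP/imsetP => [eq_r|[c _ ->]]; last exact: box_rowK.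
  have := box_col D x; rewrite eq_r => lt_c; exists (Ordinal lt_c) => //.
  by apply: (@box_inj _ D); rewrite ?box_rowK ?box_colK.
have orbE x : porbit s x = R (reshape_index D x).
  apply/setP=> y; rewrite inE; apply/porbitP/eqP => [[i ->]|eq_r].
    by rewrite permX row_iter.
  set n := nth 0%N D (reshape_index D x).
  (* Complete the turn of the row back to column 0, then advance to the column of y. *)
  exists (n - reshape_offset D x + reshape_offset D y)%N; rewrite permX.
  apply: (@box_inj _ D); rewrite ?row_iter // col_iter -/n.
  have ltx : (reshape_offset D x < n)%N := box_col D x.
  have lty : (reshape_offset D y < n)%N by rewrite /n -eq_r box_col.
  by rewrite addnA subnKC ?modnDl ?modn_small // ltnW.
have porbsE : perm_eq (enum (porbits s)) [seq R r | r <- iota 0 (size D)].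
  apply: uniq_perm => [||A]; first exact: enum_uniq.
    rewrite map_inj_in_uniq ?iota_uniq // => r r'.
    rewrite !mem_iota /= !add0n => lt_r lt_r' eqR.
    pose x := box (nth_intpart_gt0 lt_r).
    have : x \in R r by rewrite inE box_rowK.
    by rewrite eqR inE box_rowK => /eqP.
  rewrite mem_enum; apply/imsetP/mapP => [[x _ ->]|[r]].
    by exists (reshape_index D x); rewrite ?orbE // mem_iota box_row.
  rewrite mem_iota /= add0n => lt_r ->; exists (box (nth_intpart_gt0 lt_r)) => //.
  by rewrite orbE box_rowK.
apply/eqP/(@sorted_eq _ geq geq_trans geq_anti).
- exact/sort_sorted/geq_total.
- exact: intpart_sorted.
rewrite perm_sort (perm_trans (perm_map _ porbsE)) // -map_comp.
rewrite [X in perm_eq X _](_ : _ = parts D) // -[RHS](mkseq_nth 0%N).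
by apply/eq_in_map=> r; rewrite mem_iota /= add0n => /cR.
Qed.

Lemma cycle_typeV s : cycle_type s^-1 = cycle_type s.
Proof. by rewrite /cycle_type porbitsV. Qed.

End CycleType.

(** * Row and column groups *)

Section YoungGroups.
Variables (d : nat) (l : intpart d).
Implicit Types (s t : 'S_d) (x y : 'I_d).

Lemma row_groupP s :
  reflect (forall x, reshape_index l (s x) = reshape_index l x) (s \in row_group l).
Proof. by rewrite inE; apply: (iffP forallP) => H x; apply/eqP. Qed.

Lemma col_groupP s :
  reflect (forall x, reshape_offset l (s x) = reshape_offset l x) (s \in col_group l).
Proof. by rewrite inE; apply: (iffP forallP) => H x; apply/eqP. Qed.

Lemma group_set_row_group : group_set (row_group l).
Proof.
apply/group_setP; split=> [|s t /row_groupP Ps /row_groupP Pt].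
  by apply/row_groupP=> x; rewrite perm1.
by apply/row_groupP=> x; rewrite permM Pt.
Qed.

Lemma group_set_col_group : group_set (col_group l).
Proof.
apply/group_setP; split=> [|s t /col_groupP Qs /col_groupP Qt].
  by apply/col_groupP=> x; rewrite perm1.
by apply/col_groupP=> x; rewrite permM Qt.
Qed.

Canonical row_group_group := Group group_set_row_group.
Canonical col_group_group := Group group_set_col_group.

Lemma row_col_group1 s : s \in row_group l -> s \in col_group l -> s = 1%g.
Proof.
move=> /row_groupP Ps /col_groupP Qs.
by apply/permP=> x; rewrite perm1; apply: (@box_inj _ l).
Qed.

Lemma tperm_row_group x y :
  reshape_index l x = reshape_index l y -> tperm x y \in row_group l.
Proof. by move=> eq_xy; apply/row_groupP=> u; case: tpermP => [->|->|]. Qed.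

Lemma tperm_col_group x y :
  reshape_offset l x = reshape_offset l y -> tperm x y \in col_group l.
Proof. by move=> eq_xy; apply/col_groupP=> u; case: tpermP => [->|->|]. Qed.

Lemma card_row_col_lt r k :
  #|[set x : 'I_d | (reshape_index l x == r) && (reshape_offset l x < k)%N]|
    = minn (nth 0%N l r) k.
Proof.
pose h (c : 'I_(minn (nth 0%N l r) k)) :=
  box (leq_trans (ltn_ord c) (geq_minl _ _)).
have inj_h : injective h.
  move=> c c' /(congr1 (fun x : 'I_d => reshape_offset l x)).
  by rewrite !box_colK => /val_inj.
rewrite -[RHS]card_ord -(card_imset _ inj_h) //; apply: eq_card => x; rewrite inE.
apply/andP/imsetP => [[/eqP eq_r lt_k]|[c _ ->]]; last first.
  by rewrite box_rowK box_colK (leq_trans (ltn_ord c) (geq_minr _ _)).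
have lt_c : (reshape_offset l x < minn (nth 0 l r) k)%N.
  by rewrite leq_min lt_k andbT -eq_r box_col.
by exists (Ordinal lt_c) => //; apply: (@box_inj _ l); rewrite ?box_rowK ?box_colK.
Qed.

Lemma card_by_rows (A : {set 'I_d}) :
  #|A| = (\sum_(r < size l) #|[set x in A | reshape_index l (x : 'I_d) == r]|)%N.
Proof.
pose rw (x : 'I_d) : 'I_(size l) := Ordinal (box_row l x).
rewrite -sum1_card (partition_big rw xpredT) //=.
apply: eq_bigr => r _; rewrite -sum1_card; apply: eq_bigl => x.
by rewrite inE.
Qed.

(** The sum of the first k parts of the conjugate partition. Comparing these numbers for all k is
    the dominance order on conjugates. *)
Definition num_col_lt k := #|[set x : 'I_d | (reshape_offset l x < k)%N]|.

Lemma num_col_ltE k : num_col_lt k = (\sum_(r < size l) minn (nth 0 l r) k)%N.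
Proof.
rewrite /num_col_lt card_by_rows; apply: eq_bigr => r _.
by rewrite -card_row_col_lt; apply: eq_card => x; rewrite !inE andbC.
Qed.

Lemma num_col_ltS k : num_col_lt k.+1 = (num_col_lt k + count (ltn k) l)%N.
Proof.
have -> : count (ltn k) l = (\sum_(r < size l) (k < nth 0 l r))%N.
  by rewrite -sumn_count sumnE big_map (big_nth 0%N) big_mkord.
rewrite !num_col_ltE -big_split; apply: eq_bigr => r _ /=.
move: (nth _ _ _) => n; have [lt_kn|le_nk] := ltnP k n.
  by rewrite (minn_idPr lt_kn) addn1.
by rewrite (minn_idPl (leqW le_nk)) addn0.
Qed.

End YoungGroups.

Lemma num_col_lt_inj d (l m : intpart d) : num_col_lt l =1 num_col_lt m -> l = m.
Proof.
move=> eq_lm; have eq_ct k : count (ltn k) l = count (ltn k) m.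
  by apply/eqP; rewrite -(eqn_add2l (num_col_lt l k)) -num_col_ltS !eq_lm num_col_ltS.
(* [count (ltn k)] is the length of column k, and the difference of two consecutive column lengths
   is the multiplicity of the part k.+1. *)
have ctS (n : intpart d) k : count (ltn k) n = (count_mem k.+1 n + count (ltn k.+1) n)%N.
  elim: (n : seq nat) => //= a s ->; rewrite [RHS]addnACA; congr (_ + _)%N.
  by case: (ltngtP a k.+1).
apply/val_inj/(sorted_eq geq_trans geq_anti); rewrite ?intpart_sorted //.
apply/allP=> -[_ | k _] /=; first by rewrite !(count_memPn _) ?intpart_neq0.
by rewrite -(eqn_add2r (count (ltn k.+1) l)) -ctS eq_ct ctS eq_ct.
Qed.

(** When x and y witness this, [tperm x y] lies in the row group of l and its conjugate by g is a
    transposition in the column group of m. The first acts trivially and the second by -1, which is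
    what makes coefficients and products vanish. *)
Definition row_col_clash d (l m : intpart d) (g : 'S_d) :=
  [exists x : 'I_d, exists y : 'I_d,
    [&& x != y, reshape_index l x == reshape_index l y
       & reshape_offset m (g x) == reshape_offset m (g y)]].

Section NoClash.
Variables (d : nat) (l m : intpart d) (g : 'S_d).
Hypothesis no_clash : ~~ row_col_clash l m g.

Lemma no_clashP (x y : 'I_d) : reshape_index l x = reshape_index l y ->
  reshape_offset m (g x) = reshape_offset m (g y) -> x = y.
Proof.
move=> eq_r eq_c; apply/eqP/negPn/negP=> ne_xy; case/negP: no_clash.
by apply/existsP; exists x; apply/existsP; exists y; rewrite ne_xy eq_r eq_c !eqxx.
Qed.

Let row_lt r k := [set x : 'I_d | (reshape_index l x == r)
                                & (reshape_offset m (g x) < k)%N].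

(** Without a clash the boxes of one row have images in distinct columns, so at most k of them land
    in the first k columns. *)
Lemma card_no_clash_row r k : (#|row_lt r k| <= minn (nth 0 l r) k)%N.
Proof.
rewrite leq_min; apply/andP; split.
  rewrite -[nth 0%N l r]minnn -card_row_col_lt subset_leq_card //.
  apply/subsetP=> x; rewrite !inE => /andP[/eqP<- _].
  by rewrite eqxx box_col.
have [->|k_gt0] := posnP k.
  by rewrite leqn0 cards_eq0; apply/eqP/setP=> x; rewrite !inE ltn0 andbF.
pose h (x : 'I_d) : 'I_k.-1.+1 := inord (reshape_offset m (g x)).
have inj_h : {in row_lt r k &, injective h}.
  move=> x y; rewrite !inE => /andP[/eqP rx cx] /andP[/eqP ry cy] /(congr1 val) /=.
  by rewrite !inordK ?prednK // => /no_clashP; apply; rewrite rx ry.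
by rewrite -(card_in_imset inj_h) (leq_trans (max_card _)) // card_ord prednK.
Qed.

Lemma num_col_lt_no_clash k :
  num_col_lt m k = (\sum_(r < size l) #|row_lt r k|)%N.
Proof.
have -> : num_col_lt m k = #|[set x : 'I_d | (reshape_offset m (g x) < k)%N]|.
  rewrite -(card_imset _ (@perm_inj _ g)); apply: eq_card => y; rewrite inE.
  apply/idP/imsetP => [lt_y|[x]]; last by rewrite inE => lt_x ->.
  by exists ((g^-1)%g y); rewrite ?inE permKV.
rewrite (card_by_rows l); apply: eq_bigr => r _; apply: eq_card => x.
by rewrite !inE andbC.
Qed.

Lemma num_col_lt_le k : (num_col_lt m k <= num_col_lt l k)%N.
Proof.
rewrite num_col_lt_no_clash num_col_ltE.
by apply: leq_sum => r _; apply: card_no_clash_row.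
Qed.

End NoClash.

(** A clash-free g from l to m and another from m to l would give dominance both ways, and dominance
    is antisymmetric. *)
Lemma row_col_clashP d (l m : intpart d) : l != m ->
  (forall g, row_col_clash l m g) \/ (forall g, row_col_clash m l g).
Proof.
move=> ne_lm; have [/forallP|] := boolP [forall g, row_col_clash l m g]; first by left.
rewrite negb_forall => /existsP[g no_lm]; right=> h; apply: contraNT ne_lm => no_ml.
apply/eqP/num_col_lt_inj => k; apply/eqP.
by rewrite eqn_leq (num_col_lt_le no_ml) (num_col_lt_le no_lm).
Qed.

(* The row r of l has l_r boxes, and by counting those whose image lies in the
   first k columns, for every k, these images must lie in the first l_r columns:
   so they can be permuted within row r to reach the column of their image. *)
Lemma no_clash_factor d (l : intpart d) (g : 'S_d) : ~~ row_col_clash l l g ->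
  exists p q : 'S_d, [/\ p \in row_group l, q \in col_group l & g = (p * q)%g].
Proof.
move=> no_clash.
have lt_col (x : 'I_d) : (reshape_offset l (g x) < nth 0 l (reshape_index l x))%N.
  pose rx := Ordinal (box_row l x); set k := nth 0%N l _.
  (* With l on both sides the two sums over rows agree, so the bound of [card_no_clash_row] is
     attained in every row. *)
  have [_] := leqif_sum (fun (r : 'I_(size l)) (_ : true) =>
    conj (card_no_clash_row no_clash r k) (erefl _)).
  rewrite -num_col_lt_no_clash // -num_col_ltE eqxx => /esym/forallP/(_ rx)/eqP /=.
  rewrite -/k minnn -{2}[k]minnn -card_row_col_lt => eq_card.
  have : x \in [set y : 'I_d | (reshape_index l y == rx) & (reshape_offset l y < k)%N].
    by rewrite inE eqxx box_col.
  suff /(subset_cardP eq_card) <- : [set y : 'I_d | (reshape_index l y == rx)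
      & (reshape_offset l (g y) < k)%N] \subset
    [set y : 'I_d | (reshape_index l y == rx) & (reshape_offset l y < k)%N].
    by rewrite inE => /andP[].
  apply/subsetP=> y; rewrite !inE => /andP[/eqP eq_r _].
  by rewrite eq_r eqxx /k -[reshape_index l x]eq_r box_col.
pose p0 x := box (lt_col x).
have p0_inj : injective p0.
  move=> x y eq_p; apply: (no_clashP no_clash).
    by rewrite -(box_rowK (lt_col x)) [box _]eq_p box_rowK.
  by rewrite -(box_colK (lt_col x)) [box _]eq_p box_colK.
exists (perm p0_inj), ((perm p0_inj)^-1 * g)%g; split; last by rewrite mulKVg.
  by apply/row_groupP=> x; rewrite permE box_rowK.
apply/col_groupP=> x; rewrite -{2}(permKV (perm p0_inj) x) permM.
by rewrite [in RHS]permE box_colK.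
Qed.

(** * Regular representations *)

Section GroupRing.
Variables (F : fieldType) (gT : finGroupType).
Implicit Types (g h : gT) (A B c x : 'M[F]_#|[set: gT]|).
Local Notation aG := (regular_repr F [set: gT]).
Local Notation R_G := (group_ring F [set: gT]).

(** The coefficient of g when A lies in the group ring: in the row of the identity, [aG h] has its
    only 1 in the column of h. *)
Definition gcoef A g : F := A (gring_index [set: gT] 1%g) (gring_index [set: gT] g).

Lemma gcoefZ a A g : gcoef (a *: A) g = a * gcoef A g.
Proof. exact: mxE. Qed.

Lemma gcoef_sum (I : Type) (r : seq I) (P : pred I) (A : I -> 'M_#|[set: gT]|) g :
  gcoef (\sum_(i <- r | P i) A i) g = \sum_(i <- r | P i) gcoef (A i) g.
Proof. exact: summxE. Qed.

Lemma gcoefG h g : gcoef (aG h) g = (h == g)%:R.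
Proof.
rewrite /gcoef mxE gring_indexK ?inE // mul1g mxE eqxx /= eq_sym.
by rewrite -(inj_eq (can_inj (@gring_valK _ _))) !gring_indexK ?inE.
Qed.

Lemma group_ringG g : (aG g \in R_G)%MS.
Proof. by rewrite envelop_mx_id ?inE. Qed.

Lemma group_ringM A B : (A \in R_G)%MS -> (B \in R_G)%MS -> (A *m B \in R_G)%MS.
Proof. exact: envelop_mxM. Qed.

Lemma group_ringZ a A : (A \in R_G)%MS -> (a *: A \in R_G)%MS.
Proof. by move=> RA; rewrite linearZ scalemx_sub. Qed.

Lemma group_ring_sum (I : finType) (P : pred I) (A : I -> 'M_#|[set: gT]|) :
  (forall i, P i -> A i \in R_G)%MS -> (\sum_(i | P i) A i \in R_G)%MS.
Proof. by move=> RA; rewrite linear_sum summx_sub. Qed.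

Lemma group_ring_sumE A : (A \in R_G)%MS -> A = \sum_g gcoef A g *: aG g.
Proof.
case/envelop_mxP=> a defA.
have {defA} -> : A = \sum_g a g *: aG g.
  by rewrite defA; apply: eq_bigl => g; rewrite inE.
apply: eq_bigr => g _; congr (_ *: _).
rewrite gcoef_sum (bigD1 g) //= gcoefZ gcoefG eqxx mulr1 big1 ?addr0 // => h.
by rewrite gcoefZ gcoefG => /negPf->; rewrite mulr0.
Qed.

Lemma mulmx_group_ring_sumE A x B : (x \in R_G)%MS ->
  A *m x *m B = \sum_g gcoef x g *: (A *m aG g *m B).
Proof.
move=> Rx; rewrite {1}(group_ring_sumE Rx) mulmx_sumr mulmx_suml.
by apply: eq_bigr => g _; rewrite -scalemxAr -scalemxAl.
Qed.

Lemma gcoefMr A h g : gcoef (A *m aG h) g = gcoef A (g * h^-1)%g.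
Proof.
rewrite /gcoef mxE (bigD1 (gring_index [set: gT] (g * h^-1)%g)) //=.
rewrite mxE gring_indexK ?inE // mulgKV mxE !eqxx mulr1 big1 ?addr0 // => i ne_i.
rewrite mxE mxE eqxx /=; case: eqP => [e|]; last by rewrite mulr0.
case/eqP: ne_i; rewrite -[i]gring_valK; congr gring_index.
move/(congr1 enum_val): e; rewrite !gring_indexK ?inE // => ->.
by rewrite mulgK.
Qed.

Lemma gcoefM A B g : (A \in R_G)%MS -> (B \in R_G)%MS ->
  gcoef (A *m B) g = \sum_h gcoef A h * gcoef B (h^-1 * g)%g.
Proof.
move=> RA RB; rewrite {1}(group_ring_sumE RB) mulmx_sumr gcoef_sum.
rewrite (reindex (fun h => (h^-1 * g)%g)) /=; last first.
  by exists (fun h => (g * h^-1)%g) => h _; rewrite invMg ?mulgKV invgK // mulKVg.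
by apply: eq_bigr => h _; rewrite -scalemxAr gcoefZ gcoefMr invMg invgK mulKVg mulrC.
Qed.

Lemma gcoefMl A h g : (A \in R_G)%MS -> gcoef (aG h *m A) g = gcoef A (h^-1 * g)%g.
Proof.
move=> RA; rewrite gcoefM ?group_ringG // (bigD1 h) //= gcoefG eqxx mul1r.
by rewrite big1 ?addr0 // => k; rewrite gcoefG eq_sym => /negPf->; rewrite mul0r.
Qed.

Lemma gcoef_inj A B : (A \in R_G)%MS -> (B \in R_G)%MS -> gcoef A =1 gcoef B -> A = B.
Proof.
move=> /group_ring_sumE eA /group_ring_sumE eB eAB; rewrite eA eB.
by apply: eq_bigr => g _; rewrite eAB.
Qed.

Lemma group_ring_cent A :
  (forall g, A *m aG g = aG g *m A) -> forall B, (B \in R_G)%MS -> A *m B = B *m A.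
Proof.
move=> cA B /group_ring_sumE->; rewrite mulmx_sumr mulmx_suml.
by apply: eq_bigr => g _; rewrite -scalemxAr -scalemxAl cA.
Qed.

(** The map u |-> c u on the regular module. It acts on row vectors from the right, so products are
    reversed, and composing it with [aG g] gives u |-> c u g. *)
Definition lmul_mx c := lin1_mx (gring_row \o mulmx c \o gring_mx aG).

Lemma mul_rV_lmul_mx c u : u *m lmul_mx c = gring_row (c *m gring_mx aG u).
Proof. exact: mul_rV_lin1. Qed.

Lemma lmul_mxM c b : (c \in R_G)%MS -> (b \in R_G)%MS ->
  lmul_mx b *m lmul_mx c = lmul_mx (c *m b).
Proof.
move=> Rc Rb; apply/row_matrixP=> i; rewrite !rowE mulmxA !mul_rV_lmul_mx.
by rewrite gring_rowK ?mulmxA // group_ringM // gring_mxP.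
Qed.

Lemma lmul_mxZ a c : lmul_mx (a *: c) = a *: lmul_mx c.
Proof.
apply/row_matrixP=> i; rewrite !rowE -scalemxAr !mul_rV_lmul_mx -scalemxAl.
by rewrite linearZ.
Qed.

Lemma lmul_mx_cyclic c : (c \in R_G)%MS ->
  (lmul_mx c :=: cyclic_mx aG (gring_row c))%MS.
Proof.
move=> Rc; apply/eqmxP/andP; split; apply/rV_subP=> u.
  case/submxP=> v ->; rewrite mul_rV_lmul_mx; apply/cyclic_mxP.
  by exists (gring_mx aG v); rewrite ?gring_mxP // gring_row_mul.
case/cyclic_mxP=> A RA ->; apply/submxP; exists (gring_row A).
by rewrite mul_rV_lmul_mx gring_rowK // gring_row_mul.
Qed.

(** In the basis of group elements, the diagonal entry at h is the coefficient of h in c h g. *)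
Lemma tr_lmul_mxG c g :
  \tr (lmul_mx c *m aG g) = \sum_h gcoef c (h * g^-1 * h^-1)%g.
Proof.
rewrite /mxtrace (reindex (gring_index [set: gT])) /=; last first.
  exists enum_val => i _; [by rewrite gring_indexK ?inE | exact: gring_valK].
apply: eq_bigr => h _; rewrite -mulgA -[(g^-1 * _)%g]invgK invMg !invgK -gcoefMr.
rewrite repr_mxM ?inE // mulmxA /gcoef.
have -> : forall A i, A i i = (delta_mx 0 i *m A : 'rV[F]__) 0 i.
  by move=> A i; rewrite -rowE mxE.
rewrite mulmxA mul_rV_lmul_mx -gring_row_mul [LHS]mxE.
congr ((_ *m _ *m _) _ _); rewrite /gring_mx /= -rowE rowK mxvecK.
by rewrite gring_indexK ?inE.
Qed.

(** Factor A = Q B through a basis B of U. Quasi-idempotence becomes B Q = a, and cyclicity of the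
    trace moves Q past the action on U. The case a = 0 is included on purpose: [young_scal_neq0] is
    deduced from this lemma. *)
Lemma tr_submod_quasi_idem (U A : 'M[F]_#|[set: gT]|) (a : F)
    (modU : mxmodule aG U) g :
  (A :=: U)%MS -> A *m A = a *: A ->
  \tr (A *m aG g) = a * \tr (submod_repr modU g).
Proof.
move=> eqAU AA; pose B := row_base U.
have sAU : (A <= U)%MS by rewrite eqAU.
pose Q := in_submod U A.
have AE : A = Q *m B by rewrite -{1}(in_submodK sAU).
have BQ : B *m Q = a%:M.
  have /submxP[R BE] : (B <= A)%MS by rewrite eqAU eq_row_base.
  apply: (row_free_inj (row_base_free U)); rewrite -mulmxA mul_scalar_mx -/B -AE.
  by rewrite BE -mulmxA AA scalemxAr.
have BJ : B *m aG g = submod_repr modU g *m B.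
  have := val_submodJ modU 1%:M (in_setT g).
  by rewrite mul1mx /val_submod /= mul1mx => <-.
by rewrite {1}AE -mulmxA BJ mulmxA mxtrace_mulC mulmxA BQ mul_scalar_mx mxtraceZ.
Qed.

End GroupRing.

(** * Young symmetrizers *)

Section YoungSymmetrizer.
Variables (C : numFieldType) (d : nat).
Implicit Types (l m D : intpart d) (g p q : 'S_d) (x y A : 'M[C]_#|[set: 'S_d]|).
Local Notation aG := (regular_repr C [set: 'S_d]).
Local Notation R_G := (group_ring C [set: 'S_d]).
Local Notation "''c_' l" := (young_symmetrizer C l) (at level 8, l at level 2).
Local Notation sgn q := ((-1) ^+ odd_perm q : C).

Definition row_sum l : 'M[C]_#|[set: 'S_d]| := \sum_(p in row_group l) aG p.

Definition signed_col_sum l : 'M[C]_#|[set: 'S_d]| :=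
  \sum_(q in col_group l) sgn q *: aG q.

Lemma young_symmetrizerE l : 'c_l = signed_col_sum l *m row_sum l.
Proof. by []. Qed.

Lemma aGM g h : aG (g * h)%g = aG g *m aG h.
Proof. by rewrite repr_mxM ?inE. Qed.

Lemma row_sumMr l p : p \in row_group l -> row_sum l *m aG p = row_sum l.
Proof.
move=> Pp; rewrite mulmx_suml [RHS](reindex_inj (mulIg p)) /=.
by apply: eq_big => [g|g _]; rewrite ?groupMr // aGM.
Qed.

Lemma sgnM p q : sgn (p * q)%g = sgn p * sgn q.
Proof. by rewrite odd_permM signr_addb. Qed.

Lemma sgnK q : sgn q * sgn q = 1.
Proof. by rewrite -signr_addb addbb. Qed.

Lemma signed_col_sumMl l q : q \in col_group l ->
  aG q *m signed_col_sum l = sgn q *: signed_col_sum l.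
Proof.
move=> Qq; rewrite /signed_col_sum mulmx_sumr.
rewrite [in RHS](reindex_inj (mulgI q)) scaler_sumr /=.
apply: eq_big => [g|g _]; rewrite ?groupMl // aGM -scalemxAr scalerA.
by rewrite sgnM mulrA sgnK mul1r.
Qed.

Lemma group_ring_row_sum l : (row_sum l \in R_G)%MS.
Proof. by apply: group_ring_sum => p _; apply: group_ringG. Qed.

Lemma group_ring_signed_col_sum l : (signed_col_sum l \in R_G)%MS.
Proof. by apply: group_ring_sum => p _; apply/group_ringZ/group_ringG. Qed.

Lemma group_ring_young l : ('c_l \in R_G)%MS.
Proof. exact: group_ringM (group_ring_signed_col_sum l) (group_ring_row_sum l). Qed.

(** A product q p equal to 1 forces q = p = 1, as the row and column groups meet trivially. *)
Lemma gcoef_young1 l : gcoef 'c_l 1%g = 1.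
Proof.
rewrite young_symmetrizerE gcoefM ?group_ring_row_sum ?group_ring_signed_col_sum //.
have coefb g : gcoef (signed_col_sum l) g = if g \in col_group l then sgn g else 0.
  rewrite /signed_col_sum gcoef_sum; case: ifP => Qg.
    rewrite (bigD1 g) //= gcoefZ gcoefG eqxx mulr1 big1 ?addr0 // => h /andP[_ ne_h].
    by rewrite gcoefZ gcoefG (negPf ne_h) mulr0.
  rewrite big1 // => h Qh; rewrite gcoefZ gcoefG.
  by case: eqP Qg => [<-|_]; rewrite ?Qh ?mulr0.
have coefa g : gcoef (row_sum l) g = (g \in row_group l)%:R.
  rewrite /row_sum gcoef_sum; case: (boolP (g \in _)) => Pg.
    rewrite (bigD1 g) //= gcoefG eqxx big1 ?addr0 // => h /andP[_ ne_h].
    by rewrite gcoefG (negPf ne_h).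
  rewrite big1 // => h Ph; rewrite gcoefG.
  by case: eqP Pg => [<-|_] //; rewrite Ph.
rewrite (bigD1 1%g) //= big1 => [|g ne_g1]; rewrite coefb coefa.
  by rewrite invg1 mulg1 !group1 odd_perm1 mulr1 addr0.
case: ifP => Qg; rewrite ?mul0r // mulg1 groupV.
case: (boolP (g \in row_group l)) => [Pg|]; last by rewrite mulr0.
by rewrite (row_col_group1 Pg Qg) eqxx in ne_g1.
Qed.

(** The transformation law that singles out the line of the Young symmetrizer in the group ring. *)
Definition young_invariant l y :=
  forall q p, q \in col_group l -> p \in row_group l ->
    aG q *m y *m aG p = sgn q *: y.

Lemma young_invariantM l x : young_invariant l ('c_l *m x *m 'c_l).
Proof.
move=> q p Qq Pp; rewrite !young_symmetrizerE !mulmxA signed_col_sumMl //.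
by rewrite -!scalemxAl -(mulmxA _ _ (aG p)) row_sumMr.
Qed.

Lemma young_invariant_young l : young_invariant l 'c_l.
Proof.
move=> q p Qq Pp; rewrite !young_symmetrizerE !mulmxA signed_col_sumMl //.
by rewrite -!scalemxAl -(mulmxA _ _ (aG p)) row_sumMr.
Qed.

Lemma gcoef_young_invariant l y g q p : (y \in R_G)%MS -> young_invariant l y ->
  q \in col_group l -> p \in row_group l -> gcoef y (q * g * p)%g = sgn q * gcoef y g.
Proof.
move=> Ry inv_y Qq Pp.
have := inv_y (q^-1)%g (p^-1)%g; rewrite !groupV => /(_ Qq Pp).
move/(congr1 (fun A => gcoef A g)).
by rewrite gcoefZ gcoefMr gcoefMl // !invgK mulgA odd_permV.
Qed.

(** The clash provides transpositions q and p with q g p = g, so the law equates the coefficient at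
    g with its opposite. *)
Lemma gcoef_young_invariant0 l y g : (y \in R_G)%MS -> young_invariant l y ->
  row_col_clash l l g^-1 -> gcoef y g = 0.
Proof.
move=> Ry inv_y /existsP[u /existsP[v /and3P[ne_uv /eqP eq_r /eqP eq_c]]].
set q := tperm ((g^-1)%g u) ((g^-1)%g v).
have Qq : q \in col_group l by apply: tperm_col_group.
have Pp : tperm u v \in row_group l by apply: tperm_row_group.
have := gcoef_young_invariant g Ry inv_y Qq Pp.
have -> : (q * g * tperm u v)%g = g.
  have -> : q = (g * tperm u v * g^-1)%g.
    by rewrite -[LHS](tpermJ _ _ g^-1) conjgE invgK mulgA.
  by rewrite mulgKV -mulgA tperm2 mulg1.
rewrite odd_tperm (inj_eq perm_inj) ne_uv expr1 mulN1r => /eqP.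
by rewrite -addr_eq0 -mulr2n mulrn_eq0 => /eqP.
Qed.

Lemma young_invariantE l y : (y \in R_G)%MS -> young_invariant l y ->
  y = gcoef y 1 *: 'c_l.
Proof.
move=> Ry inv_y; apply: gcoef_inj; rewrite ?group_ringZ ?group_ring_young // => g.
have inv_c := @young_invariant_young l; have Rc := group_ring_young l.
rewrite gcoefZ; have [clash | no_clash] := boolP (row_col_clash l l g^-1).
  by rewrite (gcoef_young_invariant0 Ry inv_y) // (gcoef_young_invariant0 Rc inv_c) ?mulr0.
(* The factorization puts the row factor first, whereas the law has the column factor on the left;
   hence it is applied to [g^-1]. *)
have [p [q [Pp Qq /(canRL invgK)]]] := no_clash_factor no_clash.
rewrite invMg -[(q^-1)%g]mulg1 => ->.
rewrite (gcoef_young_invariant _ Ry inv_y) ?groupV //.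
by rewrite (gcoef_young_invariant _ Rc inv_c) ?groupV // gcoef_young1 mulr1 mulrC.
Qed.

Lemma young_sandwich l x : (x \in R_G)%MS ->
  'c_l *m x *m 'c_l = gcoef ('c_l *m x *m 'c_l) 1 *: 'c_l.
Proof.
move=> Rx; apply: young_invariantE; last exact: young_invariantM.
exact: group_ringM (group_ringM (group_ring_young l) Rx) (group_ring_young l).
Qed.

(** For each g, a transposition is absorbed by the row sum on its left; carried through g, it is
    absorbed by the signed column sum with the sign -1. *)
Lemma young_mul_clash l m x : (x \in R_G)%MS -> (forall g, row_col_clash l m g) ->
  'c_l *m x *m 'c_m = 0.
Proof.
move=> Rx clash; rewrite !young_symmetrizerE; set b := signed_col_sum l.
suff {b} eq0 : row_sum l *m x *m signed_col_sum m = 0.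
  by rewrite mulmxA -(mulmxA b) -(mulmxA b) eq0 mulmx0 mul0mx.
rewrite (mulmx_group_ring_sumE _ _ Rx) big1 // => g _.
apply/eqP; rewrite scaler_eq0; apply/orP; right.
have /existsP[u /existsP[v /and3P[ne_uv /eqP eq_r /eqP eq_c]]] := clash g.
have Qq : tperm (g u) (g v) \in col_group m by apply: tperm_col_group.
have Pp : tperm u v \in row_group l by apply: tperm_row_group.
have : row_sum l *m aG g *m signed_col_sum m =
       - (row_sum l *m aG g *m signed_col_sum m).
  rewrite -{1}(row_sumMr Pp) -(mulmxA _ (aG _) (aG g)) -aGM [(_ * g)%g]conjgC tpermJ aGM.
  rewrite mulmxA -(mulmxA _ _ (signed_col_sum m)) signed_col_sumMl //.
  by rewrite odd_tperm (inj_eq perm_inj) ne_uv expr1 scaleN1r mulmxN.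
by move/eqP; rewrite -addr_eq0 -mulr2n -scaler_nat scaler_eq0 pnatr_eq0.
Qed.

Definition young_scal l := gcoef ('c_l *m 'c_l) 1.

Lemma young_quasi_idem l : 'c_l *m 'c_l = young_scal l *: 'c_l.
Proof.
have := @young_sandwich l 1%:M; rewrite mulmx1; apply.
by rewrite -(repr_mx1 aG) group_ringG.
Qed.

Definition young_char l g : C := \tr (specht_repr C l g).

Lemma lmul_young l : (lmul_mx 'c_l :=: specht_mx C l)%MS.
Proof. exact/lmul_mx_cyclic/group_ring_young. Qed.

Lemma lmul_young_quasi_idem l :
  lmul_mx 'c_l *m lmul_mx 'c_l = young_scal l *: lmul_mx 'c_l.
Proof.
by rewrite lmul_mxM ?group_ring_young // young_quasi_idem lmul_mxZ.
Qed.

Lemma tr_lmul_young l g : \tr (lmul_mx 'c_l *m aG g) = young_scal l * young_char l g.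
Proof.
exact: tr_submod_quasi_idem (lmul_young l) (lmul_young_quasi_idem l).
Qed.

Lemma young_charE l g :
  young_scal l * young_char l g = \sum_h gcoef 'c_l (h * g^-1 * h^-1)%g.
Proof. by rewrite -tr_lmul_young tr_lmul_mxG. Qed.

Lemma young_char1 l : young_char l 1%g = (irr_dim C l)%:R.
Proof. by rewrite /young_char repr_mx1 mxtrace1. Qed.

(** The character formula at g = 1: each of the d! terms is the coefficient of ['c_l] at 1. *)
Lemma young_scal_dim l : young_scal l * (irr_dim C l)%:R = d`!%:R.
Proof.
rewrite -young_char1 young_charE.
under eq_bigr => h _ do rewrite invg1 mulg1 mulgV gcoef_young1.
by rewrite sumr_const card_Sn.
Qed.

Lemma young_scal_neq0 l : young_scal l != 0.
Proof.
apply/eqP=> eq0; have /esym/eqP := young_scal_dim l.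
by rewrite eq0 mul0r pnatr_eq0 -leqn0 leqNgt fact_gt0.
Qed.

Lemma irr_dim_neq0 l : (irr_dim C l)%:R != 0 :> C.
Proof.
apply/eqP=> eq0; have /esym/eqP := young_scal_dim l.
by rewrite eq0 mulr0 pnatr_eq0 -leqn0 leqNgt fact_gt0.
Qed.

Lemma young_charJ l g h : young_char l (g ^ h) = young_char l g.
Proof.
rewrite /young_char conjgE !repr_mxM ?inE // mxtrace_mulC -mulmxA -repr_mxM ?inE //.
by rewrite mulgV repr_mx1 mulmx1.
Qed.

Lemma young_charV l g : young_char l g^-1 = young_char l g.
Proof.
have [h ->] := cycle_type_conj (esym (cycle_typeV g)).
exact: young_charJ.
Qed.

(** Both characters are expanded by [young_charE], the first one at g^-1, so that g and g^-1 appear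
    in the two factors and the sum over g becomes a convolution. *)
Lemma sum_young_char_clash l m :
  young_scal l * young_scal m * (\sum_g young_char l g * young_char m g)
    = d`!%:R * \sum_k gcoef ('c_l *m aG k^-1%g *m 'c_m) k^-1%g.
Proof.
pose T := \sum_k \sum_g gcoef 'c_l g * gcoef 'c_m (k * g^-1 * k^-1)%g.
transitivity (d`!%:R * T).
  rewrite mulr_sumr.
  transitivity (\sum_h \sum_g \sum_k
      gcoef 'c_l (h * g * h^-1)%g * gcoef 'c_m (k * g^-1 * k^-1)%g).
    rewrite exchange_big; apply: eq_bigr => g _.
    rewrite mulrACA -{1}young_charV !young_charE invgK mulr_suml.
    by apply: eq_bigr => h _; rewrite mulr_sumr.
  rewrite mulr_natl -card_Sn -sumr_const; apply: eq_bigr => h _.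
  (* Substituting [g ^ h] for g and [k * h] for k makes the summand independent of h, so each of the
     d! values of h contributes T. *)
  rewrite (reindex_inj (conjg_inj h)) exchange_big (reindex_inj (mulIg h)).
  apply: eq_bigr => k _; apply: eq_bigr => g _.
  by rewrite -conjVg !conjgE !mulgA mulgV mul1g mulgK invMg !mulgA !mulgK.
congr (_ * _); apply: eq_bigr => k _.
have Rk : (aG k^-1%g *m 'c_m \in R_G)%MS.
    by rewrite group_ringM ?group_ringG ?group_ring_young.
rewrite -mulmxA gcoefM ?group_ring_young //; apply: eq_bigr => g _.
by rewrite gcoefMl ?group_ring_young // invgK mulgA.
Qed.

Lemma sum_young_char_neq l m : l != m -> \sum_g young_char l g * young_char m g = 0.
Proof.
wlog clash : l m / forall g, row_col_clash l m g.
  move=> IH ne_lm; case: (row_col_clashP ne_lm) => [/IH->//|/IH IHm].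
  rewrite eq_sym in ne_lm; rewrite -[RHS](IHm ne_lm).
  by apply: eq_bigr => g _; rewrite mulrC.
move=> _; have := sum_young_char_clash l m.
rewrite [RHS](_ : _ = 0); last first.
  rewrite big1 ?mulr0 // => k _.
  by rewrite young_mul_clash ?group_ringG // /gcoef mxE.
by move/eqP; rewrite !mulf_eq0 !(negPf (young_scal_neq0 _)) => /eqP.
Qed.

Lemma sum_young_char_eq l : \sum_g young_char l g * young_char l g = d`!%:R.
Proof.
have nz := young_scal_neq0 l.
apply: (mulfI (mulf_neq0 nz nz)); rewrite sum_young_char_clash mulrC; congr (_ * _).
(* By a cyclic reindexing, the coefficient of 1 in c_l k^-1 c_l is that of k in c_l c_l, namely n_l
   c_l(k). The remaining sum over k is the coefficient of 1 in c_l c_l, which is n_l again. *)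
transitivity (\sum_k young_scal l * (gcoef 'c_l k * gcoef 'c_l (k^-1 * 1)%g)).
  apply: eq_bigr => k _; rewrite young_sandwich ?group_ringG // gcoefZ mulrA mulg1.
  congr (_ * _); rewrite -[RHS]gcoefZ -young_quasi_idem -mulmxA.
  have Rk : (aG k^-1%g *m 'c_l \in R_G)%MS.
    by rewrite group_ringM ?group_ringG ?group_ring_young.
  rewrite !gcoefM ?group_ring_young //.
  rewrite [RHS](reindex_inj (inj_comp (mulgI k) (@invg_inj _))) /=.
  apply: eq_bigr => h _; rewrite gcoefMl ?group_ring_young // invgK mulg1 mulrC.
  by rewrite invMg invgK mulgKV.
by rewrite -mulr_sumr -gcoefM ?group_ring_young.
Qed.

End YoungSymmetrizer.

Arguments young_char C {d} l g.
Arguments young_scal C {d} l.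

(** * Class sums *)

Lemma sum_delta_inv (F : fieldType) (I : finType) (X Y : I -> I -> F) :
  (forall i k, \sum_j X i j * Y j k = (i == k)%:R) ->
  forall j k, \sum_i Y j i * X i k = (j == k)%:R.
Proof.
move=> XY j k; pose mx (Z : I -> I -> F) :=
  \matrix_(a < #|I|, b < #|I|) Z (enum_val a) (enum_val b).
have mxM Z1 Z2 a b : (mx Z1 *m mx Z2) a b = \sum_i Z1 (enum_val a) i * Z2 i (enum_val b).
  rewrite mxE (reindex (@enum_val I predT)); last exact/onW_bij/enum_val_bij.
  by apply: eq_bigr => i _; rewrite !mxE.
have /mulmx1C/matrixP/(_ (enum_rank j) (enum_rank k)) : mx X *m mx Y = 1%:M.
  by apply/matrixP=> a b; rewrite mxM XY mxE (inj_eq enum_val_inj).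
by rewrite mxM !enum_rankK mxE (inj_eq enum_rank_inj).
Qed.

Section ClassAlgebra.
Variables (C : numFieldType) (d : nat).
Implicit Types (l m D E : intpart d) (g h : 'S_d) (A B : 'M[C]_#|[set: 'S_d]|).
Local Notation aG := (regular_repr C [set: 'S_d]).
Local Notation R_G := (group_ring C [set: 'S_d]).

Lemma mem_repr_cclass D : repr (cclass D) \in cclass D.
Proof. by have [g /mem_repr] := cclass_neq0 D. Qed.

Lemma cclassJ g h D : ((g ^ h)%g \in cclass D) = (g \in cclass D).
Proof. by rewrite !inE cycle_typeJ. Qed.

Lemma cclass_conj g h D : g \in cclass D -> h \in cclass D -> exists u, h = (g ^ u)%g.
Proof. by rewrite !inE => /eqP gD /eqP hD; apply: cycle_type_conj; rewrite gD. Qed.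

Lemma card_cclass_neq0 D : #|cclass D|%:R != 0 :> C.
Proof.
by rewrite pnatr_eq0 -lt0n card_gt0; apply/set0Pn/cclass_neq0.
Qed.

Lemma sum_by_cclass (V : nmodType) (f : 'S_d -> V) :
  \sum_g f g = \sum_D \sum_(g in cclass D) f g.
Proof.
rewrite (partition_big (@cycle_part d) xpredT) //=; apply: eq_bigr => D _.
by apply: eq_bigl => g; rewrite mem_cclass.
Qed.

Lemma young_char_cclass l g D : g \in cclass D -> young_char C l g = Defs.irr_char C l D.
Proof.
move=> Dg; have [u ->] := cclass_conj (mem_repr_cclass D) Dg.
exact: young_charJ.
Qed.

Lemma irr_dim_phi l D : (irr_dim C l)%:R * phi C l D = #|cclass D|%:R * Defs.irr_char C l D.
Proof. by rewrite /phi !mulrA mulfV ?mul1r ?irr_dim_neq0. Qed.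

Lemma fact_neq0 : d`!%:R != 0 :> C.
Proof. by rewrite pnatr_eq0 -lt0n fact_gt0. Qed.

Lemma phi_row_orthogonal l m :
  \sum_D (irr_dim C l)%:R * phi C l D * ((irr_dim C m)%:R * phi C m D) / #|cclass D|%:R
    = (l == m)%:R * d`!%:R.
Proof.
transitivity (\sum_g young_char C l g * young_char C m g).
  rewrite sum_by_cclass; apply: eq_bigr => D _.
  rewrite (eq_bigr (fun=> Defs.irr_char C l D * Defs.irr_char C m D)); last first.
    by move=> g Dg; rewrite !(young_char_cclass _ Dg).
  rewrite sumr_const !irr_dim_phi mulrACA mulrAC mulfK ?card_cclass_neq0 //.
  by rewrite mulr_natl.
have [<-|ne_lm] := eqVneq; first by rewrite sum_young_char_eq mul1r.
by rewrite sum_young_char_neq // mul0r.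
Qed.

Lemma phi_col_orthogonal D D' :
  \sum_l ((irr_dim C l)%:R / d`!%:R) ^+ 2 * (phi C l D * phi C l D')
    = (D == D')%:R * (#|cclass D|%:R / d`!%:R).
Proof.
have nzd := fact_neq0.
(* The row relations divide by d! and by class sizes; putting one divisor on each side turns them
   into X Y = 1, whose reversal Y X = 1 gives the column relations. *)
pose X l E := (irr_dim C l)%:R * phi C l E / d`!%:R.
pose Y E l := (irr_dim C l)%:R * phi C l E / #|cclass E|%:R.
have XY l m : \sum_E X l E * Y E m = (l == m)%:R.
  rewrite -[RHS](mulfK nzd) -phi_row_orthogonal mulr_suml.
  apply: eq_bigr => E _; have nzE := card_cclass_neq0 E.
  by rewrite /X /Y; field; rewrite nzd nzE.
rewrite -(sum_delta_inv XY) mulr_suml; apply: eq_bigr => l _.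
have nzD := card_cclass_neq0 D.
by rewrite /X /Y; field; rewrite nzd nzD.
Qed.

Lemma gcoef_class_sum D g : gcoef (class_sum C D) g = (g \in cclass D)%:R.
Proof.
rewrite gcoef_sum; case: (boolP (g \in _)) => Dg.
  rewrite (bigD1 g) //= gcoefG eqxx big1 ?addr0 // => h /andP[_ ne_h].
  by rewrite gcoefG (negPf ne_h).
rewrite big1 // => h Dh; rewrite gcoefG.
by case: eqP Dg => [<-|_] //; rewrite Dh.
Qed.

Lemma group_ring_class_sum D : (class_sum C D \in R_G)%MS.
Proof. by apply: group_ring_sum => g _; apply: group_ringG. Qed.

Lemma class_sum_centG D g : class_sum C D *m aG g = aG g *m class_sum C D.
Proof.
apply: gcoef_inj => [||h]; rewrite ?group_ringM ?group_ringG ?group_ring_class_sum //.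
rewrite gcoefMr gcoefMl ?group_ring_class_sum // !gcoef_class_sum.
by rewrite -(cclassJ (h * _) g) conjgE mulgKV.
Qed.

Lemma class_sum_cent D A : (A \in R_G)%MS -> class_sum C D *m A = A *m class_sum C D.
Proof. exact/group_ring_cent/class_sum_centG. Qed.

(** Commuting with every [aG g] makes the coefficients constant on conjugacy classes, so any
    representative gives them. *)
Lemma center_sum_class_sum A : (A \in 'Z(R_G))%MS ->
  A = \sum_D gcoef A (repr (cclass D)) *: class_sum C D.
Proof.
case/center_mxP=> RA cA; rewrite {1}(group_ring_sumE RA) sum_by_cclass.
apply: eq_bigr => D _; rewrite scaler_sumr; apply: eq_bigr => g Dg; congr (_ *: _).
have [u ->] := cclass_conj (mem_repr_cclass D) Dg.
set r := repr _; rewrite conjgE -gcoefMl // cA ?group_ringG //.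
by rewrite gcoefMr mulgK.
Qed.

Lemma center_class_sum D : (class_sum C D \in 'Z(R_G))%MS.
Proof.
apply/center_mxP; split=> [|B RB]; first exact: group_ring_class_sum.
by rewrite class_sum_cent.
Qed.

Lemma class_sum_coord (a : intpart d -> C) E :
  gcoef (\sum_D a D *: class_sum C D) (repr (cclass E)) = a E.
Proof.
rewrite gcoef_sum (bigD1 E) //= gcoefZ gcoef_class_sum mem_repr_cclass mulr1.
rewrite big1 ?addr0 // => D ne_DE; rewrite gcoefZ gcoef_class_sum mem_cclass.
have := mem_repr_cclass E; rewrite mem_cclass => /eqP->.
by rewrite eq_sym (negPf ne_DE) mulr0.
Qed.

Lemma young_neq0 l : young_symmetrizer C l != 0.
Proof.
by apply: contraNneq (oner_neq0 C) => c0; rewrite -(gcoef_young1 C l) c0 /gcoef mxE.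
Qed.

(** With K the class sum, n_l K c = K c c = c K c is a multiple of c. The trace of u |-> c u K on
    the regular module then identifies the scalar. *)
Lemma class_sum_young l D :
  class_sum C D *m young_symmetrizer C l = phi C l D *: young_symmetrizer C l.
Proof.
set c := young_symmetrizer C l; set K := class_sum C D.
have Rc : (c \in R_G)%MS := group_ring_young C l.
have RK : (K \in R_G)%MS := group_ring_class_sum D.
have nz := young_scal_neq0 C l.
have [w Kc] : exists w, K *m c = w *: c.
  exists ((young_scal C l)^-1 * gcoef (c *m K *m c) 1).
  rewrite -scalerA -young_sandwich // -/c -class_sum_cent // -mulmxA young_quasi_idem.
  by rewrite -scalemxAr scalerA mulVf // scale1r.
rewrite Kc; congr (_ *: _).
have LK : lmul_mx c *m K = w *: lmul_mx c.
  apply/row_matrixP=> i; rewrite !rowE mulmxA mul_rV_lmul_mx -gring_row_mul -mulmxA.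
  rewrite -class_sum_cent ?gring_mxP // mulmxA -class_sum_cent // Kc.
  by rewrite -scalemxAr mul_rV_lmul_mx -scalemxAl linearZ.
have trK : \tr (lmul_mx c *m K) = young_scal C l * (#|cclass D|%:R * Defs.irr_char C l D).
  rewrite mulmx_sumr linear_sum mulr_natl -sumr_const mulr_sumr.
  by apply: eq_bigr => g Dg; rewrite /= tr_lmul_young (young_char_cclass _ Dg).
have trL : \tr (lmul_mx c) = young_scal C l * (irr_dim C l)%:R.
  by rewrite -young_char1 -tr_lmul_young repr_mx1 mulmx1.
move: trK; rewrite LK mxtraceZ trL -irr_dim_phi mulrCA => /(mulfI nz).
by rewrite mulrC => /(mulfI (irr_dim_neq0 C l)).
Qed.

Lemma center_class_sumM D1 D2 : (class_sum C D1 *m class_sum C D2 \in 'Z(R_G))%MS.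
Proof.
apply/center_mxP; split; first by rewrite group_ringM ?group_ring_class_sum.
move=> B RB.
by rewrite mulmxA -(class_sum_cent D1 RB) -!mulmxA (class_sum_cent D2 RB).
Qed.

(** Both sides are the scalar by which the product of the two class sums acts on c_l. *)
Lemma phiM_center A D1 D2 l : A = class_sum C D1 *m class_sum C D2 ->
  phi C l D1 * phi C l D2 = \sum_E gcoef A (repr (cclass E)) * phi C l E.
Proof.
move=> defA; have ZA : (A \in 'Z(R_G))%MS.
  by rewrite defA center_class_sumM.
apply/eqP; rewrite -subr_eq0; apply/eqP.
have : (phi C l D1 * phi C l D2 - \sum_E gcoef A (repr (cclass E)) * phi C l E)
         *: young_symmetrizer C l = 0.
  rewrite scalerBl mulrC -scalerA -class_sum_young scalemxAr -class_sum_young.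
  rewrite mulmxA -defA {1}(center_sum_class_sum ZA) mulmx_suml scaler_suml.
  rewrite -sumrB big1 // => E _.
  by rewrite -scalemxAl class_sum_young scalerA subrr.
by move/eqP; rewrite scaler_eq0 (negPf (young_neq0 l)) orbF => /eqP.
Qed.

Lemma hurwitz0E (Ds : seq (intpart d)) : hurwitz C 0 Ds =
  \sum_l ((irr_dim C l)%:R / d`!%:R) ^+ 2 * \prod_(D <- Ds) phi C l D.
Proof. by []. Qed.

(** After phi(D1) phi(D2) is expanded over the classes E, column orthogonality against D3 keeps only
    E = D3, and its value |C_D3| / d! cancels the prefactor. *)
Lemma struct_constE D1 D2 D3 : struct_const C D1 D2 D3 =
  gcoef (class_sum C D1 *m class_sum C D2) (repr (cclass D3)).
Proof.
set A := _ *m _; rewrite /struct_const hurwitz0E.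
rewrite (eq_bigr (fun l => \sum_E gcoef A (repr (cclass E)) *
    (((irr_dim C l)%:R / d`!%:R) ^+ 2 * (phi C l E * phi C l D3)))).
  rewrite exchange_big /= (bigD1 D3) //= -mulr_sumr phi_col_orthogonal eqxx mul1r.
  rewrite big1 ?addr0 => [|E ne_E].
    have nd := fact_neq0; have nD := card_cclass_neq0 D3.
    by field; rewrite nd nD.
  by rewrite -mulr_sumr phi_col_orthogonal (negPf ne_E) mul0r mulr0.
move=> l _; rewrite !big_cons big_nil mulr1 mulrA (phiM_center l (erefl A)).
by rewrite mulr_suml mulr_sumr; apply: eq_bigr => E _; ring.
Qed.

Lemma class_sumM D1 D2 : class_sum C D1 *m class_sum C D2 =
  \sum_D3 struct_const C D1 D2 D3 *: class_sum C D3.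
Proof.
rewrite [LHS](center_sum_class_sum (center_class_sumM D1 D2)).
by apply: eq_bigr => E _; rewrite struct_constE.
Qed.

Lemma phiM l D1 D2 : phi C l D1 * phi C l D2 =
  \sum_D3 struct_const C D1 D2 D3 * phi C l D3.
Proof.
rewrite (phiM_center l (erefl _)).
by apply: eq_bigr => E _; rewrite struct_constE.
Qed.

Lemma class_sum_lin_indep (a b : intpart d -> C) :
  \sum_D a D *: class_sum C D = \sum_D b D *: class_sum C D -> a =1 b.
Proof. by move=> eq_ab E; rewrite -class_sum_coord eq_ab class_sum_coord. Qed.

End ClassAlgebra.

(** * Differentiation of monomials *)

Section Polynomials.
Variable C : fieldType.
Implicit Types (m : {cmonom nat}) (D : seq nat).

Lemma tvar_partE D : tvar_part C D = << part_mon D >>.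
Proof.
rewrite /tvar_part; elim: D => [|k D IHD]; first by rewrite big_nil.
by rewrite big_cons IHD [LHS]malgM_def fgmulUU mulr1; exact: erefl.
Qed.

Lemma tderivU k (a : C) m :
  tderiv k << a *g m >> = << a *+ m k.-1 *g divcm m (ucm k.-1) >>.
Proof.
rewrite /tderiv msuppU; have [->|_] := eqVneq a 0.
  by rewrite mul0rn big_seq_fset0 !monalgU0.
by rewrite big_seq_fset1 mcoeffUU.
Qed.

Lemma divcmA m1 m2 m3 : divcm (divcm m1 m2) m3 = divcm m1 (mulcm m2 m3).
Proof. by apply/eqP/cmP=> i; rewrite !divcmE mulcmE subnDA. Qed.

Lemma divcm0 m : divcm m (onecm nat) = m.
Proof. by apply/eqP/cmP=> i; rewrite divcmE onecmE subn0. Qed.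

Lemma divcmm m : divcm m m = onecm nat.
Proof. by apply/eqP/cmP=> i; rewrite divcmE onecmE subnn. Qed.

Lemma mulcmC m1 m2 : mulcm m1 m2 = mulcm m2 m1.
Proof. by apply/eqP/cmP=> i; rewrite !mulcmE addnC. Qed.

(** Repeated differentiation produces falling factorials of the exponents. The subtraction in
    [divcm] is truncated, but whenever an exponent is too small its falling factorial is 0. The
    bound n lets the product range over a finite type. *)
Lemma foldr_tderivU n m D : all (fun k => 0 < k <= n)%N D ->
  foldr (@tderiv C) << m >> D =
    << (\prod_(i < n) m i ^_ (part_mon D i))%:R *g divcm m (part_mon D) >>.
Proof.
elim: D => [_|k D IHD] /=.
  rewrite divcm0 big1 // => i _; by rewrite onecmE ffactn0.
case/andP=> /andP[k0 kn] /IHD ->; rewrite tderivU divcmA [mulcm (part_mon D) _]mulcmC.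
have kn' : (k.-1 < n)%N by rewrite prednK.
congr << _ *g _ >>; rewrite -mulrnA divcmE; congr _%:R.
rewrite (bigD1 (Ordinal kn')) //= [in RHS](bigD1 (Ordinal kn')) //=.
rewrite mulcmE ucmE eqxx add1n ffactnSr mulnAC; congr (_ * _)%N.
apply: eq_bigr => i ne_i; rewrite mulcmE ucmE eq_sym.
by rewrite -(inj_eq val_inj) /= in ne_i; rewrite (negPf ne_i).
Qed.

Lemma twgt_eq0 m : twgt m = 0%N -> m = onecm nat.
Proof.
move=> /eqP; rewrite /twgt sum_nat_seq_eq0 => /allP m0; apply/eqP/cmP=> i.
rewrite onecmE; have [/m0|/fsfun_dflt//] := boolP (i \in finsupp m).
by rewrite muln_eq0 orbF => /eqP.
Qed.

Lemma part_factE n D : all (fun k => 0 < k <= n)%N D ->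
  part_fact D = (\prod_(i < n) (part_mon D i)`!)%N.
Proof.
move=> allD; have D0 : 0%N \notin D.
  by apply/negP=> /(allP allD).
transitivity (\prod_(1 <= k < n.+1) (count_mem k D)`!)%N; last first.
  by rewrite big_add1 big_mkord; apply: eq_bigr => i _; rewrite part_monE.
rewrite /index_iota subn1 /=.
rewrite (bigID (mem D)) /= [X in (_ * X)%N]big1 ?muln1; last first.
  by move=> k /count_memPn->.
rewrite -big_filter; apply: perm_big; apply: uniq_perm => [||k].
- exact: undup_uniq.
- by rewrite filter_uniq ?iota_uniq.
rewrite mem_undup mem_filter mem_iota add1n ltnS /=.
by case: (boolP (k \in D)) => // /(allP allD).
Qed.

Lemma scale_monU1 (a : C) : a != 0 -> a^-1 *: (<< a *g onecm nat >> : tpoly C) = 1.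
Proof.
move=> a0; transitivity (<< onecm nat >> : tpoly C); last exact: erefl.
apply/malgP=> m; rewrite mcoeffZ [RHS]mcoeffU (mcoeffU (onecm nat) a m).
by case: (onecm nat == m); [exact: mulVf | exact: mulr0].
Qed.

Lemma part_fact_gt0 D : (0 < part_fact D)%N.
Proof. by rewrite /part_fact prodn_gt0 // => k; apply: fact_gt0. Qed.

End Polynomials.

(** * Duality between the products p_E and the derivatives of the same degree *)

Section DualBasis.
Variables (C : numFieldType) (d : nat).
Implicit Types D E : intpart d.

Lemma intpart_bound D : all (fun k => 0 < k <= d)%N D.
Proof.
apply/allP=> k kD; rewrite lt0n -(sumn_intpart D) leq_sumn // andbT.
by apply: contraNneq (intpart_neq0 D) => <-.
Qed.

(** A nonzero result requires that p_D divide p_E; as both have weight d, the quotient has weight 0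
    and D = E. In that case the falling factorials are full factorials, and their product is the
    normalizing [part_fact D]. *)
Lemma tderiv_tvar_part D E :
  tderiv_part D (tvar_part C E) = if D == E then 1 else 0.
Proof.
rewrite /tderiv_part tvar_partE (foldr_tderivU _ _ (intpart_bound D)).
have [<-|ne_DE] := eqVneq.
  rewrite divcmm (eq_bigr (fun i : 'I_d => (part_mon D i)`!)); last first.
    by move=> i _; rewrite ffactnn.
  rewrite -(part_factE (intpart_bound D)).
  by apply: scale_monU1; rewrite pnatr_eq0 -lt0n part_fact_gt0.
set N := (\prod_(i < d) _)%N; suff -> : N = 0%N by rewrite monalgU0 scaler0.
apply/eqP; apply: contraNT ne_DE; rewrite -lt0n => N_gt0.
have le_DE i : (part_mon D i <= part_mon E i)%N.
  have [lt_id|le_di] := ltnP i d.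
    rewrite leqNgt; apply: contraTN N_gt0 => lt_ED.
    by rewrite /N (bigD1 (Ordinal lt_id)) //= ffact_small.
  rewrite part_monE ?intpart_neq0 // (count_memPn _) //.
  by apply/negP=> /(allP (intpart_bound D)); rewrite /= ltnNge le_di.
have eqE : part_mon E = mulcm (part_mon D) (divcm (part_mon E) (part_mon D)).
  by apply/eqP/cmP=> i; rewrite mulcmE divcmE subnKC.
have w0 : twgt (divcm (part_mon E) (part_mon D)) = 0%N.
  apply/eqP; rewrite -(eqn_add2l (twgt (part_mon D))) -twgtM -eqE addn0.
  by rewrite !twgt_part_mon ?intpart_neq0 // !sumn_intpart.
apply/eqP/esym/part_mon_inj/eqP/cmP=> i; rewrite eqE (twgt_eq0 w0).
by rewrite mulcmE onecmE addn0.
Qed.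

End DualBasis.

Lemma cut_join_tvar (C : numFieldType) d (D E : intpart d) (z : C) :
  cut_join D z (tvar_part C E) = \sum_(G : intpart d)
    (d`!%:R / #|cclass E|%:R * z ^ (d%:Z + (size E)%:Z - (size D)%:Z - (size G)%:Z)
      * hurwitz C 0 [:: E; D; G]) *: tvar_part C G.
Proof.
apply: eq_bigr => G _.
rewrite (bigD1 E isT).
rewrite tderiv_tvar_part eqxx.
rewrite mulr1.
rewrite big1.
  exact: addr0.
move=> G' /negPf ne_G'.
rewrite tderiv_tvar_part.
rewrite ne_G'.
rewrite mulr0.
exact: scaler0.
Qed.

(** * Cut-and-join operators *)

Section StructureConstants.
Variables (C : numFieldType) (d : nat).
Implicit Types (l D E G H : intpart d).
Local Notation sc := (struct_const C).

(** The partition with d parts equal to 1; its class sum is the unit and its product of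
    time-variables is p_1^d. *)
Definition unit_part : intpart d := cycle_part 1.

Lemma cclass_unit_part : cclass unit_part = [set 1%g].
Proof.
apply/setP=> g; rewrite inE [in RHS]inE; apply/eqP/eqP => [eq_g|->//].
by have [u ->] := cycle_type_conj (esym eq_g); rewrite conj1g.
Qed.

Lemma class_sum_unit_part : class_sum C unit_part = 1%:M.
Proof. by rewrite /class_sum /gset_mx cclass_unit_part big_set1 repr_mx1. Qed.

Lemma struct_constC D E G : sc D E G = sc E D G.
Proof.
rewrite !struct_constE class_sum_cent //; exact: group_ring_class_sum.
Qed.

Lemma struct_const1 D E : sc D unit_part E = (D == E)%:R.
Proof.
rewrite struct_constE class_sum_unit_part mulmx1 gcoef_class_sum mem_cclass.
by have := mem_repr_cclass E; rewrite mem_cclass => /eqP->; rewrite eq_sym.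
Qed.

(** Multiplied by |C_G|, the structure constant is d! times a Hurwitz number, which is symmetric in
    the three partitions. *)
Lemma struct_const_rot D E G :
  sc D E G * #|cclass G|%:R = sc D G E * #|cclass E|%:R.
Proof.
have nG := card_cclass_neq0 C G; have nE := card_cclass_neq0 C E.
rewrite /struct_const (_ : hurwitz C 0 [:: D; G; E] = hurwitz C 0 [:: D; E; G]).
  by field; rewrite nG nE.
apply: eq_bigr => l _; congr (_ * _); apply: perm_big.
by rewrite perm_cons (perm_catC [:: G]).
Qed.

Lemma struct_const_to1 D E :
  sc D E unit_part = (D == E)%:R * #|cclass D|%:R.
Proof.
have := struct_const_rot D E unit_part.
rewrite cclass_unit_part cards1 mulr1 struct_const1 => ->.
by have [->|] := eqVneq D E; rewrite ?mul0r.
Qed.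

(** The two sides are the coordinates at E of the two bracketings of a product of three class
    sums. *)
Lemma struct_constA D1 D2 D3 E :
  \sum_G sc D1 D2 G * sc G D3 E = \sum_G sc D2 D3 G * sc D1 G E.
Proof.
have K1 : class_sum C D1 *m class_sum C D2 *m class_sum C D3 =
    \sum_E (\sum_G sc D1 D2 G * sc G D3 E) *: class_sum C E.
  rewrite class_sumM mulmx_suml (eq_bigr _ (fun G _ => esym (scalemxAl _ _ _))).
  under eq_bigr => G _ do rewrite class_sumM scaler_sumr.
  rewrite exchange_big; apply: eq_bigr => F _; rewrite scaler_suml.
  by apply: eq_bigr => G _; rewrite scalerA.
have K2 : class_sum C D1 *m (class_sum C D2 *m class_sum C D3) =
    \sum_E (\sum_G sc D2 D3 G * sc D1 G E) *: class_sum C E.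
  rewrite (class_sumM C D2) mulmx_sumr (eq_bigr _ (fun G _ => esym (scalemxAr _ _ _))).
  under eq_bigr => G _ do rewrite class_sumM scaler_sumr.
  rewrite exchange_big; apply: eq_bigr => F _; rewrite scaler_suml.
  by apply: eq_bigr => G _; rewrite scalerA.
have /class_sum_lin_indep := etrans (esym K1) (etrans (esym (mulmxA _ _ _)) K2).
exact.
Qed.

Lemma phi_unit_part l : phi C l unit_part = 1.
Proof.
apply/eqP; rewrite -subr_eq0.
have /eqP : (phi C l unit_part - 1) *: young_symmetrizer C l = 0.
  by rewrite scalerBl -class_sum_young class_sum_unit_part mul1mx scale1r subrr.
by rewrite scaler_eq0 (negPf (young_neq0 C l)) orbF.
Qed.

End StructureConstants.

Arguments unit_part {d}.

(** * The normalized operators in the basis of the p_G *)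

Section CutJoin.
Variables (C : numFieldType) (d : nat) (z : C).
Hypothesis hz : z != 0.
Implicit Types (l D E G H : intpart d).
Local Notation sc := (struct_const C).

Lemma tvar_part_subproof G : tvar_part C G \in thomog C d.
Proof. by rewrite -[d in thomog _ d](sumn_intpart G) thomog_tvar_part ?intpart_neq0. Qed.

Definition tvar_fun G : tfun C d := TFun (tvar_part_subproof G).

Lemma tfun_sumE (I : Type) (r : seq I) (P : pred I) (F : I -> tfun C d) :
  tfun_val (\sum_(i <- r | P i) F i) = \sum_(i <- r | P i) tfun_val (F i).
Proof. exact: (raddf_sum (\val : tfun C d -> tpoly C)). Qed.

Lemma tfun_scaleE a (f : tfun C d) : tfun_val (a *: f) = a *: tfun_val f.
Proof. exact: GRing.valZ. Qed.

Definition tfun_coef E (f : tfun C d) : C := (tfun_val f)@_(part_mon E).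

Lemma tfun_coefZ E a f : tfun_coef E (a *: f) = a * tfun_coef E f.
Proof. by rewrite /tfun_coef tfun_scaleE; exact: mcoeffZ. Qed.

Lemma tfun_coefD E f g : tfun_coef E (f + g) = tfun_coef E f + tfun_coef E g.
Proof. exact: mcoeffD. Qed.

Lemma tfun_coef_tvar G E : tfun_coef E (tvar_fun G) = (G == E)%:R.
Proof.
rewrite /tfun_coef /= tvar_partE mcoeffU1; congr (_ %:R); congr nat_of_bool.
exact: (inj_eq (@part_mon_inj d)).
Qed.

Lemma tfun_coef_sum E (a : intpart d -> C) :
  tfun_coef E (\sum_G a G *: tvar_fun G) = a E.
Proof.
have -> : tfun_coef E (\sum_G a G *: tvar_fun G) =
          \sum_G tfun_coef E (a G *: tvar_fun G).
  by rewrite /tfun_coef tfun_sumE; exact: raddf_sum.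
rewrite (bigD1 E) //= tfun_coefZ tfun_coef_tvar eqxx mulr1 big1 ?addr0 // => G.
by move=> /negPf ne_GE; rewrite tfun_coefZ tfun_coef_tvar ne_GE mulr0.
Qed.

Lemma tfunE (f : tfun C d) : f = \sum_G tfun_coef G f *: tvar_fun G.
Proof.
apply: (can_inj (@tfun_coordK C d)); apply/rowP=> i; rewrite !mxE.
exact/esym/(tfun_coef_sum (enum_val i) (tfun_coef^~ f)).
Qed.

(** The coefficient of p_G in the image of p_E. Its power of z is v(E) / v(G) with v(G) = z^l(G), so
    it telescopes when operators are composed. *)
Definition cut_join_coef D E G : C := z ^ ((size E)%:Z - (size G)%:Z) * sc D G E.

Lemma W_hat_tvar D E : W_hat D z (tvar_fun E) = \sum_G cut_join_coef D E G *: tvar_fun G.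
Proof.
apply: val_inj; rewrite [LHS]W_hatE [RHS]tfun_sumE /cut_join_hat cut_join_tvar.
rewrite [LHS]scaler_sumr; apply: eq_bigr => G _; rewrite [RHS]tfun_scaleE.
apply: etrans (scalerA _ _ _) _; apply: (congr1 ( *:%R ^~ (tvar_part C G))).
rewrite /cut_join_coef /struct_const.
rewrite (_ : hurwitz C 0 [:: E; D; G] = hurwitz C 0 [:: D; G; E]); last first.
  apply: eq_bigr => l _; congr (_ * _); apply: perm_big.
  by rewrite (perm_catC [:: E]).
have -> : z ^ ((size E)%:Z - (size G)%:Z) = z ^ (- d%:Z + (size D)%:Z)
    * z ^ (d%:Z + (size E)%:Z - (size D)%:Z - (size G)%:Z).
  by rewrite -expfzDr //; congr (_ ^ _); ring.
by move: (hurwitz _ _ _) (_ / _) => h a; ring.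
Qed.

Lemma eq_End_tvar (T U : 'End(tfun C d)) :
  (forall E, T (tvar_fun E) = U (tvar_fun E)) -> T = U.
Proof.
move=> eqTU; apply/lfunP=> f; rewrite (tfunE f) !linear_sum.
by apply: eq_bigr => E _; rewrite !linearZ /= eqTU.
Qed.

Lemma W_hat_comp D1 D2 : (W_hat D1 z \o W_hat D2 z)%VF =
  \sum_D3 sc D1 D2 D3 *: W_hat D3 z.
Proof.
apply: eq_End_tvar => E; rewrite comp_lfunE sum_lfunE W_hat_tvar linear_sum.
under eq_bigr => G _ do rewrite linearZ /= W_hat_tvar scaler_sumr.
under [RHS]eq_bigr => D3 _ do rewrite scale_lfunE W_hat_tvar scaler_sumr.
rewrite exchange_big [RHS]exchange_big; apply: eq_bigr => H _ /=.
under eq_bigr => G _ do rewrite scalerA.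
under [RHS]eq_bigr => D3 _ do rewrite scalerA.
rewrite -[LHS]scaler_suml -[RHS]scaler_suml.
apply: (congr1 ( *:%R ^~ (tvar_fun H))).
transitivity (z ^ ((size E)%:Z - (size H)%:Z) * \sum_G sc D1 H G * sc D2 G E).
  rewrite mulr_sumr; apply: eq_bigr => G _; rewrite /cut_join_coef.
  have -> : z ^ ((size E)%:Z - (size H)%:Z) =
            z ^ ((size E)%:Z - (size G)%:Z) * z ^ ((size G)%:Z - (size H)%:Z).
    by rewrite -expfzDr //; congr (_ ^ _); ring.
  by ring.
(* Because of the transposition, D1 acts on H before D2 does; associativity regroups this as the
   product of D2 and D1, and commutativity restores the order. *)
rewrite -struct_constA mulr_sumr; apply: eq_bigr => D3 _.
by rewrite mulrCA (struct_constC _ D2).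
Qed.

Lemma W_hat_unit_part : W_hat (@unit_part d) z = \1%VF.
Proof.
apply: eq_End_tvar => E; rewrite W_hat_tvar id_lfunE (bigD1 E) //=.
rewrite /cut_join_coef subrr expr0z struct_constC struct_const1 eqxx mulr1 scale1r.
rewrite big1 ?addr0 // => G /negPf ne_GE.
by rewrite struct_constC struct_const1 ne_GE mulr0 scale0r.
Qed.

Lemma W_hat_tvar_unit_part D : W_hat D z (tvar_fun unit_part) =
  (z ^ ((size (@unit_part d))%:Z - (size D)%:Z) * #|cclass D|%:R) *: tvar_fun D.
Proof.
rewrite W_hat_tvar (bigD1 D) //= big1 ?addr0 => [|G]; last first.
  by rewrite eq_sym /cut_join_coef struct_const_to1 => /negPf->;
    rewrite mul0r mulr0 scale0r.
by rewrite /cut_join_coef struct_const_to1 eqxx mul1r.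
Qed.

(* An operator of the algebra is determined by its value on p_1^d, and the
   image of p_1^d under W_hat D z is a nonzero multiple of p_D. *)
Definition center_of_op (T : 'End(tfun C d)) : 'M[C]_#|[set: 'S_d]| :=
  \sum_D (tfun_coef D (T (tvar_fun unit_part))
          / (z ^ ((size (@unit_part d))%:Z - (size D)%:Z) * #|cclass D|%:R))
    *: class_sum C D.

Lemma center_of_op_is_linear : linear center_of_op.
Proof.
move=> a T U; rewrite /center_of_op scaler_sumr -big_split /=; apply: eq_bigr => D _.
rewrite scalerA -scalerDl; congr (_ *: _); rewrite add_lfunE scale_lfunE.
by rewrite tfun_coefD tfun_coefZ mulrDl mulrA.
Qed.

HB.instance Definition _ := GRing.isLinear.Build C 'End(tfun C d)
  'M[C]_#|[set: 'S_d]| _ center_of_op center_of_op_is_linear.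

Lemma center_of_op_W_hat D : center_of_op (W_hat D z) = class_sum C D.
Proof.
rewrite /center_of_op W_hat_tvar_unit_part (bigD1 D) //= big1 => [|E /negPf ne_ED].
  rewrite addr0 tfun_coefZ tfun_coef_tvar eqxx mulr1 divff ?scale1r //.
  by rewrite mulf_neq0 ?card_cclass_neq0 // expfz_neq0.
by rewrite tfun_coefZ tfun_coef_tvar eq_sym ne_ED mulr0 mul0r scale0r.
Qed.

Lemma W_algP T : reflect (exists t : intpart d -> C, T = \sum_D t D *: W_hat D z)
                         (T \in W_alg d z).
Proof.
rewrite /W_alg span_def big_map; apply: (iffP idP) => [|[t ->]].
  rewrite big_enum => /memv_sumP[v Wv ->].
  have /fin_all_exists[t vE] D : exists a, v D = a *: W_hat D z by apply/vlineP/Wv.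
  by exists t; apply: eq_bigr => D _.
rewrite rpred_sum // => D _; apply: memvZ; rewrite big_enum /=.
by apply: (subvP (sumv_sup D _ (subvv _))); rewrite ?memv_line.
Qed.

Definition schur_fun l : tfun C d := \sum_(G : intpart d)
  (z ^ (- d%:Z - (size G)%:Z) * ((irr_dim C l)%:R / d`!%:R) * phi C l G) *: tvar_fun G.

Lemma schur_funE l : tfun_val (schur_fun l) = schur l z.
Proof. by rewrite tfun_sumE; apply: eq_bigr => G _; rewrite tfun_scaleE. Qed.

(** The coefficient of p_1^d is a power of z times dim / d!, since phi is 1 at the identity
    class. *)
Lemma schur_neq0 l : schur l z != 0.
Proof.
rewrite -schur_funE; apply/eqP=> s0.
have /eqP : tfun_coef unit_part (schur_fun l) = 0 by rewrite /tfun_coef s0 mcoeff0.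
rewrite tfun_coef_sum phi_unit_part mulr1 !mulf_eq0 invr_eq0.
by rewrite (negPf (fact_neq0 _ _)) (negPf (irr_dim_neq0 _ _)) expfz_eq0 (negPf hz) andbF.
Qed.

(** Up to powers of z, the coefficients of the Schur function are the phi_l(G). Multiplicativity of
    phi_l says that this vector is an eigenvector of the transpose of multiplication by a class
    sum. *)
Lemma W_hat_schur D l : W_hat D z (schur_fun l) = phi C l D *: schur_fun l.
Proof.
rewrite [in LHS]/schur_fun linear_sum.
under eq_bigr => E _ do rewrite linearZ /= W_hat_tvar scaler_sumr.
rewrite exchange_big scaler_sumr; apply: eq_bigr => G _ /=.
under eq_bigr => E _ do rewrite scalerA.
rewrite -[LHS]scaler_suml [RHS]scalerA.
apply: (congr1 ( *:%R ^~ (tvar_fun G))).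
transitivity (z ^ (- d%:Z - (size G)%:Z) * ((irr_dim C l)%:R / d`!%:R)
              * \sum_E sc D G E * phi C l E).
  rewrite mulr_sumr; apply: eq_bigr => E _; rewrite /cut_join_coef.
  have -> : z ^ (- d%:Z - (size G)%:Z) =
            z ^ (- d%:Z - (size E)%:Z) * z ^ ((size E)%:Z - (size G)%:Z).
    by rewrite -expfzDr //; congr (_ ^ _); ring.
  by ring.
by rewrite -phiM; ring.
Qed.

End CutJoin.

Theorem corollary3p6 (C : numClosedFieldType) (d : nat) (z : C) (hz : z != 0) :
  [/\ (* the W_hat D z span a commutative associative algebra of operators *)
      [/\ (\1%VF : 'End(tfun C d)) \in W_alg d z,
          {in W_alg d z &, forall T U, (T \o U)%VF \in W_alg d z},
          {in W_alg d z & &, forall T U V,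
             (T \o (U \o V))%VF = ((T \o U) \o V)%VF}
        & {in W_alg d z &, forall T U, (T \o U)%VF = (U \o T)%VF}],
      (* multiplication rule *)
      forall D1 D2 : intpart d,
        (W_hat D1 z \o W_hat D2 z)%VF =
          \sum_(D3 : intpart d) struct_const C D1 D2 D3 *: W_hat D3 z,
      (* its coefficients are the structure constants of the center of
         C[S_d] in the basis of the class sums *)
      free [seq class_sum C D | D : intpart d] /\
      (forall D1 D2 : intpart d,
        class_sum C D1 *m class_sum C D2 =
          \sum_(D3 : intpart d) struct_const C D1 D2 D3 *: class_sum C D3),
      (* algebra isomorphism from W_alg d z onto the center of C[S_d] *)
      exists Phi : 'Hom('End(tfun C d), 'M[C]_#|[set: 'S_d]|),
        [/\ forall D : intpart d, Phi (W_hat D z) = class_sum C D,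
            {in W_alg d z &, injective Phi},
            forall A, (A \in 'Z(group_ring C [set: 'S_d]))%MS <->
                      exists2 T, T \in W_alg d z & Phi T = A,
            {in W_alg d z &, forall T U, Phi (T \o U)%VF = Phi T *m Phi U}
          & Phi \1%VF = 1%:M]
    & (* eigenfunctions *)
      forall l : intpart d,
        schur l z != 0 /\
        forall D : intpart d,
          cut_join_hat D z (schur l z) = phi C l D *: schur l z].
Proof.
have WM D1 D2 := W_hat_comp hz D1 D2.
have idW : (\1%VF : 'End(tfun C d)) = W_hat unit_part z by rewrite W_hat_unit_part.
have W_in D : W_hat D z \in W_alg d z.
  by apply: memv_span; apply: image_f.
have compW t u : ((\sum_D t D *: W_hat D z) \o (\sum_D u D *: W_hat D z))%VF =
    \sum_D1 \sum_D2 (t D1 * u D2) *: (W_hat D1 z \o W_hat D2 z)%VF.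
  apply/lfunP=> f; rewrite comp_lfunE !sum_lfunE; apply: eq_bigr => D1 _.
  rewrite sum_lfunE scale_lfunE linear_sum scaler_sumr; apply: eq_bigr => D2 _.
  by rewrite !scale_lfunE linearZ /= scalerA comp_lfunE.
split.
- split.
  + by rewrite idW.
  + move=> _ _ /W_algP[t ->] /W_algP[u ->]; rewrite compW.
    apply: rpred_sum => D1 _; apply: rpred_sum => D2 _; apply: rpredZ.
    by rewrite WM; apply: rpred_sum => D3 _; apply: rpredZ.
  + by move=> T U V _ _ _; apply: comp_lfunA.
  + move=> _ _ /W_algP[t ->] /W_algP[u ->]; rewrite !compW exchange_big /=.
    apply: eq_bigr => D1 _; apply: eq_bigr => D2 _; rewrite mulrC !WM.
    congr (_ *: _); apply: eq_bigr => D3 _; by rewrite struct_constC.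
- exact: WM.
- split; last exact: class_sumM.
  (* [freeP] numbers the family by positions while [class_sum_lin_indep] uses partitions;
     [enum_rank] and [enum_val] pass between the two. *)
  apply/(@freeP _ _ _ (image_tuple (@class_sum C d) {: intpart d})) => k k0 i.
  rewrite -[i]enum_valK.
  apply: (@class_sum_lin_indep _ _ (fun D => k (enum_rank D)) (fun=> 0)).
  rewrite [RHS]big1 => [|D _]; last exact: scale0r.
  rewrite -[RHS]k0 (reindex (@enum_val (intpart d) predT)) /=; last first.
    exact/onW_bij/enum_val_bij.
  by apply: eq_bigr => j _; rewrite enum_valK nth_image.
- exists (linfun (center_of_op z)).
  have PhiW D : linfun (center_of_op z) (W_hat D z) = class_sum C D.
    by rewrite lfunE /= center_of_op_W_hat.
  have Phi_sum t : linfun (center_of_op z) (\sum_D t D *: W_hat D z) =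
      \sum_D t D *: class_sum C D.
    by rewrite linear_sum; apply: eq_bigr => D _; rewrite linearZ /= PhiW.
  split.
  + exact: PhiW.
  + move=> _ _ /W_algP[t ->] /W_algP[u ->]; rewrite !Phi_sum => /class_sum_lin_indep tu.
    by apply: eq_bigr => D _; rewrite tu.
  + move=> A; split=> [/center_sum_class_sum eA | [T /W_algP[t ->] <-]].
      (* A preimage of a central element is the combination of operators with the same
         coordinates. *)
      exists (\sum_D gcoef A (repr (cclass D)) *: W_hat D z); last by rewrite Phi_sum -eA.
      by apply/W_algP; eexists.
    rewrite Phi_sum linear_sum summx_sub // => D _.
    by rewrite linearZ scalemx_sub // center_class_sum.
  + move=> _ _ /W_algP[t ->] /W_algP[u ->]; rewrite compW !Phi_sum linear_sum mulmx_suml.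
    apply: eq_bigr => D1 _; rewrite linear_sum mulmx_sumr; apply: eq_bigr => D2 _.
    by rewrite linearZ /= WM Phi_sum -scalemxAl -scalemxAr scalerA class_sumM.
  + by rewrite idW PhiW class_sum_unit_part.
- move=> l; split; first exact: schur_neq0.
  by move=> D; rewrite -schur_funE -W_hatE W_hat_schur // tfun_scaleE.
Qed.
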